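(* Let $\mathcal{A}$ be a complex Banach algebra with unity, $a,b,c\in\mathcal{A}$, $k$ a positive integer, and $M=\begin{pmatrix}a&b\\ c&0\end{pmatrix}\in M_{2}(\mathcal{A})$. Suppose $a(bc)\alpha_{1}\cdots\alpha_{k}=0$ for all $\alpha_{1},\dots,\alpha_{k}\in\{a,bc\}$. Then $a$ and $bc$ are both g$\pi$-Hirano invertible in $\mathcal{A}$ if and only if $M$ is g$\pi$-Hirano invertible in $M_{2}(\mathcal{A})$.
   Context: $M_{2}(\mathcal{A})$ is the Banach algebra of $2\times2$ matrices over $\mathcal{A}$. For a unital Banach algebra $\mathcal{B}$, $\mathcal{B}^{qnil}$ is the set of elements with spectrum $\{0\}$, and $a\in\mathcal{B}$ is g$\pi$-Hirano invertible if there exists $x\in\mathcal{B}$ with $xax=x$, $ax=xa$ and $a-a^{n+2}x\in\mathcal{B}^{qnil}$ for some positive integer $n$. *)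

(* Defs.v *)
From HB Require Import structures.
From mathcomp Require Import all_boot all_order all_algebra.
From mathcomp Require Import complex.
From mathcomp Require Import reals.
Set Implicit Arguments. Unset Strict Implicit. Unset Printing Implicit Defensive.
Import Order.TTheory GRing.Theory Num.Theory.
Local Open Scope ring_scope.
Local Open Scope complex_scope.

Definition banach_algebra (R : realType) (A : algType R[i]) (nrm : A -> R) : Prop :=
  (forall x, 0 <= nrm x) /\
  (forall x, nrm x = 0 <-> x = 0) /\
  (forall x y, nrm (x + y) <= nrm x + nrm y) /\
  (forall (l : R[i]) x, (nrm (l *: x))%:C = `|l| * (nrm x)%:C) /\
  (forall x y, nrm (x * y) <= nrm x * nrm y) /\
  nrm 1 = 1 /\
  (forall u : nat -> A,
        (forall e : R, 0 < e -> exists N, forall m n, (N <= m)%N -> (N <= n)%N ->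
            nrm (u m - u n) < e) ->
        exists l, forall e : R, 0 < e -> exists N, forall n, (N <= n)%N ->
            nrm (u n - l) < e).

Definition invertible (B : pzRingType) (x : B) : Prop :=
  exists y, x * y = 1 /\ y * x = 1.

(* spectrum of x in the unital ring B, where s embeds the complex scalars
   (s l = l * 1_B) *)
Definition spectrum (R : realType) (B : pzRingType) (s : R[i] -> B) (x : B)
  : R[i] -> Prop := fun l => ~ invertible (s l - x).

Definition qnil (R : realType) (B : pzRingType) (s : R[i] -> B) (x : B) : Prop :=
  forall l, spectrum s x l <-> l = 0.

Definition gpi_hirano (R : realType) (B : pzRingType) (s : R[i] -> B) (a : B)
  : Prop :=
  exists x : B, [/\ x * a * x = x, a * x = x * a &
    exists n : nat, (0 < n)%N /\ qnil s (a - a ^+ (n + 2) * x)].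

Definition scalA (R : realType) (A : algType R[i]) (l : R[i]) : A := l%:A.
Definition scalM2 (R : realType) (A : algType R[i]) (l : R[i]) : 'M[A]_2 :=
  (l%:A : A)%:M.

Definition M2 (A : pzRingType) (a b c : A) : 'M[A]_2 :=
  \matrix_(i < 2, j < 2)
    if (i == 0 :> nat) then (if (j == 0 :> nat) then a else b)
    else (if (j == 0 :> nat) then c else 0).

(* Main.v *)
(* Both directions go through one spectral criterion, valid in any complex Banach
   algebra: x is g-pi-Hirano invertible iff for some n >= 1 its spectrum consists of
   solutions of l^(n+1) = l.  For "if", v = x^n - x^(2n) is quasinilpotent, and an
   idempotent p = x^n + v z is found by solving a quadratic equation by iteration, in
   a norm adapted to v; x is invertible on the corner of p and quasinilpotent on the
   complementary corner.

   For l <> 0 the matrix l - M is invertible iff T = l^2 - l a - b c is, and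
   (l - a)(l^2 - b c) = l T + a (b c).  The hypothesis makes a (b c) T^-1 nilpotent,
   so T is invertible iff the product (l - a)(l^2 - b c) is.  Invertibility of a
   product only gives one-sided inverses of the factors, but it holds for all l off
   a finite set, and x - l has no one-sided inverse when l is a boundary point of the
   spectrum of x. *)
From Stdlib Require Ncring Ncring_tac.
Require Import Defs.
From HB Require Import structures.
From mathcomp Require Import all_boot all_order all_algebra.
From mathcomp Require Import complex.
From mathcomp Require Import reals.
From mathcomp Require Import boolp classical_sets topology normedtype lra.
Set Implicit Arguments.
Unset Strict Implicit.
Unset Printing Implicit Defensive.
Import Order.TTheory GRing.Theory Num.Theory.
Import ComplexField.Normc.
Import numFieldNormedType.Exports.
Local Open Scope ring_scope.

(** * Normalisation of identities in noncommutative rings *)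

Section NoncommutativeRing.
Variable B : pzRingType.

#[global] Instance pzRing_ring_ops :
  @Ncring.Ring_ops B (0 : B) (1 : B) (@GRing.add B) (@GRing.mul B)
    (fun x y : B => x - y) (@GRing.opp B) (@eq B).
Defined.

#[global] Instance pzRing_ring : @Ncring.Ring B _ _ _ _ _ _ _ pzRing_ring_ops.
Proof.
constructor; try exact _; rewrite /=.
- exact: add0r.
- exact: addrC.
- exact: addrA.
- exact: mul1r.
- exact: mulr1.
- exact: mulrA.
- exact: mulrDl.
- by move=> x y z; exact: mulrDr.
- by [].
- exact: subrr.
Qed.

End NoncommutativeRing.

Ltac ncring := rewrite ?expr2; Ncring_tac.non_commutative_ring.

(** * Invertible elements of a unital ring *)

Section Invertible.
Variable B : pzRingType.
Implicit Types x y z : B.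

Lemma invertible1 : invertible (1 : B).
Proof. by exists 1; rewrite mulr1. Qed.

Lemma invertibleM x y : invertible x -> invertible y -> invertible (x * y).
Proof.
move=> [x' [xx' x'x]] [y' [yy' y'y]]; exists (y' * x'); split.
  by rewrite mulrA -(mulrA x) yy' mulr1.
by rewrite mulrA -(mulrA y') x'x mulr1.
Qed.

Lemma invertible_lr x y z : x * y = 1 -> z * x = 1 -> invertible x.
Proof.
move=> xy zx; exists y; split=> //.
by rewrite -[y]mul1r -zx -(mulrA z) xy mulr1.
Qed.

Lemma invertibleN x : invertible x -> invertible (- x).
Proof. by move=> [y [xy yx]]; exists (- y); rewrite !mulrNN. Qed.

Lemma comm_inverse x y z :
  x * y = 1 -> y * x = 1 -> GRing.comm z x -> GRing.comm z y.
Proof.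
move=> xy yx zx; rewrite /GRing.comm -[z in LHS]mul1r -yx -(mulrA y) -zx.
by rewrite -!mulrA xy mulr1.
Qed.

(** Commutation puts [x] at either end of the product, so an inverse of the product yields both a
    right and a left inverse of [x]. *)
Lemma invertible_comm_factor x y :
  GRing.comm x y -> invertible (x * y) -> invertible x.
Proof.
move=> cxy [z [xyz zxy]]; apply: (@invertible_lr x (y * z) (z * y)).
  by rewrite mulrA.
by rewrite -mulrA -cxy.
Qed.

(** The geometric sum is a cofactor of [1 - x] that commutes with it. *)
Lemma invertible_1subX x n : invertible (1 - x ^+ n) -> invertible (1 - x).
Proof.
have -> : 1 - x ^+ n = (1 - x) * (\sum_(i < n) x ^+ i).
  by rewrite -opprB subrX1 -mulNr opprB.
apply: invertible_comm_factor.
apply: commr_sum => i _; apply: commrX; apply: commr_sym.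
by apply: commrB; [exact: commr1|].
Qed.

Lemma invertible_nilpotent x n : x ^+ n = 0 -> invertible (1 - x).
Proof.
by move=> x0; apply: (@invertible_1subX _ n); rewrite x0 subr0; exact: invertible1.
Qed.

(* Peirce decomposition: x is invertible as soon as it agrees with invertible
   elements on the two corners of p. *)
Lemma invertible_corners p x u v : p * p = p -> GRing.comm p x ->
  GRing.comm p u -> GRing.comm p v -> x * p = u * p ->
  x * (1 - p) = v * (1 - p) -> invertible u -> invertible v -> invertible x.
Proof.
move=> pp cx cu cv xu xv [u' [uu' u'u]] [v' [vv' v'v]].
have cu' := comm_inverse uu' u'u cu; have cv' := comm_inverse vv' v'v cv.
have Ep : p * u' = u' * p by []. have Eq : p * v' = v' * p by [].
have E1 : x * (p * u') = p.
  by rewrite mulrA xu -mulrA Ep mulrA uu' mul1r.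
have E2 : x * ((1 - p) * v') = 1 - p.
  rewrite mulrA xv -mulrA mulrBl mul1r Eq -[v' in v' - _]mulr1 -mulrBr.
  by rewrite mulrA vv' mul1r.
have E3 : (u' * p) * x = p.
  by rewrite -mulrA cx xu mulrA u'u mul1r.
have E4 : (v' * (1 - p)) * x = 1 - p.
  rewrite -mulrA mulrBl mul1r cx -[x in x - _]mulr1 -mulrBr xv.
  by rewrite mulrA v'v mul1r.
exists (p * u' + (1 - p) * v'); split.
  by rewrite mulrDr E1 E2 addrC subrK.
have -> : (1 - p) * v' = v' * (1 - p) by rewrite mulrBl mulrBr mul1r mulr1 Eq.
by rewrite mulrDl Ep E3 E4 addrC subrK.
Qed.

End Invertible.

Lemma invertible_scale (K : fieldType) (B : nzRingType) (s : {rmorphism K -> B})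
  l (x : B) : l != 0 -> invertible x -> invertible (s l * x).
Proof.
move=> l0; apply: invertibleM; exists (s l^-1).
by rewrite -!rmorphM mulfV // mulVf // rmorph1.
Qed.

(** Common interface for [A] and for its 2 by 2 matrices: scalars act through a central ring
    morphism, and the norm of 1 may exceed 1, as it does for the entrywise sum norm on matrices. *)
Record banach_over_complex (R : realType) (B : nzRingType)
    (s : {rmorphism R[i] -> B}) (nrm : B -> R) : Prop := BanachOverComplex {
  banach_central : forall l x, s l * x = x * s l;
  banach_ge0 : forall x, 0 <= nrm x;
  banach_eq0 : forall x, nrm x = 0 -> x = 0;
  banach_leD : forall x y, nrm (x + y) <= nrm x + nrm y;
  banach_scale : forall l x, nrm (s l * x) = normc l * nrm x;
  banach_leM : forall x y, nrm (x * y) <= nrm x * nrm y;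
  banach_complete : forall u : nat -> B,
    (forall e : R, 0 < e -> exists N, forall m n, (N <= m)%N -> (N <= n)%N ->
       nrm (u m - u n) < e) ->
    exists l, forall e : R, 0 < e -> exists N, forall n, (N <= n)%N ->
       nrm (u n - l) < e }.

(** * Real estimates by powers of 1/2 *)

Section Halves.
Variable R : realType.

Lemma half_exp_small (D e : R) : 0 < e -> exists N, D * 2^-1 ^+ N < e.
Proof.
move=> e0; have [D0|D0] := lerP D 0.
  exists 0%N; rewrite expr0 mulr1; exact: le_lt_trans e0.
exists (Num.bound (D / e)).
set N := Num.bound _.
have h : D / e < N%:R by apply: archi_boundP; rewrite divr_ge0 // ltW.
have h2 : N%:R <= 2 ^+ N :> R by rewrite -natrX ler_nat ltnW // ltn_expl.
rewrite exprVn ltr_pdivrMr ?exprn_gt0 // mulrC -ltr_pdivrMr //.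
exact: lt_le_trans h h2.
Qed.

Lemma half_exp_le0 (D x : R) : (forall k, x <= D * 2^-1 ^+ k) -> x <= 0.
Proof.
move=> H; rewrite leNgt; apply/negP => x0.
have [N] := half_exp_small D x0; have := H N; lra.
Qed.

End Halves.

(** * Norm estimates and the Neumann series *)

Section Neumann.
Variables (R : realType) (B : nzRingType) (s : {rmorphism R[i] -> B}).
Variables (nrm : B -> R) (hB : banach_over_complex s nrm).
Implicit Types x y z w : B.

Lemma bnrm_ge0 x : 0 <= nrm x. Proof. exact: (banach_ge0 hB). Qed.
Hint Resolve bnrm_ge0 : core.

Lemma bnrm0 : nrm 0 = 0.
Proof. by have := banach_scale hB 0 0; rewrite mulr0 normc0 mul0r. Qed.

Lemma bnrmN x : nrm (- x) = nrm x.
Proof.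
have := banach_scale hB (-1) x.
have -> : normc (-1 : R[i]) = 1 by rewrite (@normcN R) normc1.
by rewrite rmorphN1 mulN1r mul1r.
Qed.

Lemma bnrm_leD x y : nrm (x + y) <= nrm x + nrm y.
Proof. exact: (banach_leD hB). Qed.

Lemma bnrm_leM x y : nrm (x * y) <= nrm x * nrm y.
Proof. exact: (banach_leM hB). Qed.

Lemma bnrm_leB x y : nrm (x - y) <= nrm x + nrm y.
Proof. by rewrite -(bnrmN y) bnrm_leD. Qed.

Lemma bnrm_distC x y : nrm (x - y) = nrm (y - x).
Proof. by rewrite -bnrmN opprB. Qed.

Lemma bnrm_le_distD z x y : nrm (x - y) <= nrm (x - z) + nrm (z - y).
Proof. by apply: le_trans (bnrm_leD _ _); rewrite addrA subrK. Qed.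

Lemma bnrm_eq0 x : nrm x <= 0 -> x = 0.
Proof. by move=> x0; apply: (banach_eq0 hB); apply/eqP; rewrite eq_le x0 /=. Qed.

Lemma bnrm_leX x n : (0 < n)%N -> nrm (x ^+ n) <= nrm x ^+ n.
Proof.
case: n => // n _; elim: n => [|n IH]; first by rewrite !expr1.
rewrite exprS [X in _ <= X]exprS; apply: le_trans (bnrm_leM _ _) _.
exact: ler_wpM2l.
Qed.

Lemma bnrm1_ge1 : 1 <= nrm 1.
Proof.
have h : nrm 1 * 1 <= nrm 1 * nrm 1 by rewrite mulr1 -{1}[1]mulr1 bnrm_leM.
have n0 : 0 < nrm 1.
  rewrite lt_neqAle bnrm_ge0 andbT eq_sym.
  by apply/eqP => /(banach_eq0 hB)/eqP; rewrite oner_eq0.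
by rewrite ler_pM2l in h.
Qed.

Lemma geometric_limit (u : nat -> B) (D : R) :
  (forall k, nrm (u k.+1 - u k) <= D * 2^-1 ^+ k) ->
  exists l, forall k, nrm (u k - l) <= 2 * D * 2^-1 ^+ k.
Proof.
move=> Hu.
(* The factor [1 - 2^-1 ^+ j] comes from the exact partial geometric sum, so that the induction
   closes with an equality. *)
have Huj k j : nrm (u (k + j)%N - u k) <= 2 * D * 2^-1 ^+ k * (1 - 2^-1 ^+ j).
  elim: j => [|j IH]; first by rewrite addn0 subrr bnrm0 expr0 subrr mulr0.
  rewrite addnS; have h1 := bnrm_le_distD (u (k + j)%N) (u (k + j).+1) (u k).
  have h2 := Hu (k + j)%N; apply: le_trans h1 _.
  rewrite exprD in h2; rewrite exprS.
  set a := 2^-1 ^+ k in IH h2 *; set b := 2^-1 ^+ j in IH h2 *.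
  apply: le_trans (lerD h2 IH) _; rewrite le_eqVlt; apply/orP; left; apply/eqP.
  lra.
have D0 : 0 <= D by have := Hu 0%N; rewrite expr0 mulr1; exact: le_trans.
have Hkn k n : (k <= n)%N -> nrm (u n - u k) <= 2 * D * 2^-1 ^+ k.
  move=> kn; rewrite -(subnKC kn); apply: le_trans (Huj _ _) _.
  have h0 : 0 <= 2 * D * 2^-1 ^+ k :> R by rewrite !mulr_ge0 // exprn_ge0 // invr_ge0.
  rewrite -[X in _ <= X]mulr1; apply: ler_wpM2l => //.
  by rewrite gerBl exprn_ge0 // invr_ge0.
have [|l Hl] := banach_complete hB (u := u).
  move=> e e0; have [N HN] := half_exp_small (4 * D) e0.
  exists N => m n Nm Nn.
  have h1 := Hkn _ _ Nm; have h2 := Hkn _ _ Nn; rewrite bnrm_distC in h2.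
  have := bnrm_le_distD (u N) (u m) (u n); lra.
exists l => k; apply/ler_addgt0Pr => e e0.
have [N HN] := Hl e e0; pose n := maxn N k.
have h1 := HN n (leq_maxl _ _); have h2 := Hkn _ _ (leq_maxr N k).
rewrite bnrm_distC in h2; have := bnrm_le_distD (u n) (u k) l; rewrite /n in h1 *; lra.
Qed.

Lemma invertible_1sub_small y : nrm y <= 2^-1 -> invertible (1 - y).
Proof.
move=> hy; pose u k := \sum_(i < k) y ^+ i.
have yk k : nrm (y ^+ k) <= nrm 1 * 2^-1 ^+ k.
  case: k => [|k]; first by rewrite !expr0 mulr1.
  apply: le_trans (bnrm_leX _ _) _ => //.
  rewrite -[X in X <= _]mul1r; apply: ler_pM => //; first by rewrite exprn_ge0.
    exact: bnrm1_ge1.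
  by apply: lerXn2r => //; rewrite ?nnegrE ?invr_ge0.
have [|l Hl] := @geometric_limit u (nrm 1).
  by move=> k; rewrite /u big_ord_recr /= addrAC subrr add0r.
have uk k : (1 - y) * u k = 1 - y ^+ k.
  by rewrite -opprB mulNr -subrX1 opprB.
have uk' k : u k * (1 - y) = 1 - y ^+ k.
  rewrite -uk; apply/commr_sym/commr_sum => i _; apply/commrX/commr_sym.
  by apply: commrB; [exact: commr1|].
exists l; split; apply/subr0_eq/bnrm_eq0.
  (* The error has two parts, [y ^+ k] and the distance from [u k] to its limit, each bounded by a
     constant times [2^-1 ^+ k]. *)
  apply: (@half_exp_le0 _ (nrm 1 + nrm (1 - y) * (2 * nrm 1))) => k.
  have -> : (1 - y) * l - 1 = - y ^+ k - (1 - y) * (u k - l).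
    by rewrite mulrBr uk; ncring.
  apply: le_trans (bnrm_leB _ _) _; rewrite bnrmN.
  have h1 := yk k; have h2 := Hl k.
  have h3 := le_trans (bnrm_leM _ _) (ler_wpM2l (bnrm_ge0 (1 - y)) h2).
  lra.
apply: (@half_exp_le0 _ (nrm 1 + nrm (1 - y) * (2 * nrm 1))) => k.
have -> : l * (1 - y) - 1 = - y ^+ k - (u k - l) * (1 - y).
  by rewrite mulrBl uk'; ncring.
apply: le_trans (bnrm_leB _ _) _; rewrite bnrmN.
have h1 := yk k; have h2 := Hl k.
have h3 := le_trans (bnrm_leM _ _) (ler_wpM2r (bnrm_ge0 (1 - y)) h2).
lra.
Qed.

Lemma invertible_1subX_small y N : nrm (y ^+ N) <= 2^-1 -> invertible (1 - y).
Proof. by move/invertible_1sub_small; exact: invertible_1subX. Qed.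

End Neumann.

(** * The complex modulus and roots of -1 *)

Section NormC.
Variable R : realType.

Lemma normcX (l : R[i]) n : normc (l ^+ n) = normc l ^+ n.
Proof.
elim: n => [|n IH]; first by rewrite !expr0 normc1.
by rewrite !exprS normcM IH.
Qed.

Lemma normc_ge0 (l : R[i]) : 0 <= normc l.
Proof. by case: l => x y; rewrite /= sqrtr_ge0. Qed.

Lemma normcR (x : R) : normc x%:C%C = `|x|.
Proof. by rewrite /= expr0n addr0 sqrtr_sqr. Qed.

Lemma normc_rect (x y : R) : normc (x +i* y)%C <= `|x| + `|y|.
Proof.
rewrite /normc -[X in _ <= X]ger0_norm ?addr_ge0 // -sqrtr_sqr ler_wsqrtr //.
rewrite sqrrD !real_normK ?num_real // lerD2r lerDl.
by rewrite mulrn_wge0 // mulr_ge0.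
Qed.

Lemma rect_normc (x y : R) : `|x| <= normc (x +i* y)%C /\ `|y| <= normc (x +i* y)%C.
Proof. by split; rewrite /normc -sqrtr_sqr ler_wsqrtr // ?lerDl ?lerDr sqr_ge0. Qed.

(** Supplies the rotation of the scalar that changes the sign of a power with exponent [2 ^ m] and
    stays in the same disc. *)
Lemma root_of_minus_one m :
  exists z : R[i], z ^+ (2 ^ m) = -1 /\ normc z = 1.
Proof.
have n0 : (0 < 2 ^ m)%N by rewrite expn_gt0.
exists ((2 ^ m).-root (-1)); have h := rootCK n0 (-1 : R[i]); split=> //.
apply/eqP; rewrite -(@pexpr_eq1 _ _ (2 ^ m)) ?normc_ge0 //.
by rewrite -normcX h (@normcN R) normc1.
Qed.

End NormC.

(** * The resolvent and norms of powers of a quasinilpotent element *)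

Section SpectralRadius.
Variables (R : realType) (B : nzRingType) (s : {rmorphism R[i] -> B}).
Variables (nrm : B -> R) (hB : banach_over_complex s nrm).
Implicit Types x y z w : B.
Let bge0 := bnrm_ge0 hB.
Hint Resolve bge0 : core.

(** Written with [1 - s l * w] instead of [s l - w], so that the resolvent is defined on the whole
    plane, 0 included; [qnilP] compares it with [qnil]. *)
Definition quasinilpotent w := forall l, invertible (1 - s l * w).

Definition resolvent w (f : R[i] -> B) :=
  forall l, (1 - s l * w) * f l = 1 /\ f l * (1 - s l * w) = 1.

Lemma resolvent_exists w : quasinilpotent w -> exists f, resolvent w f.
Proof. by move=> /choice[f Hf]; exists f. Qed.

(** The resolvent identity: the difference is [f l * ((1 - s l * w) - (1 - s m * w)) * f m], with
    the central scalars pulled out. *)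
Lemma resolvent_sub w f l m :
  resolvent w f -> f m - f l = s (m - l) * (f l * w * f m).
Proof.
move=> Hf; have [lf fl] := Hf l; have [mf fm] := Hf m.
have -> : f m - f l = f l * (1 - s l * w) * f m - f l * ((1 - s m * w) * f m).
  by rewrite fl mf mul1r mulr1.
rewrite rmorphB.
have -> : (s m - s l) * (f l * w * f m) = (s m * f l - s l * f l) * w * f m by ncring.
by rewrite !(banach_central hB _ (f l)); ncring.
Qed.

Lemma resolvent_sub_le w f l m : resolvent w f ->
  nrm (f m - f l) <= normc (m - l) * (nrm (f l) * nrm w * nrm (f m)).
Proof.
move=> Hf; rewrite (resolvent_sub l m Hf) (banach_scale hB).
apply: ler_wpM2l; first exact: normc_ge0.
apply: le_trans (bnrm_leM hB _ _) _; apply: ler_wpM2r => //.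
exact: (bnrm_leM hB).
Qed.

(** Near [l] the resolvent identity gives [nrm (f m - f l) <= nrm (f m) / 2], hence
    [nrm (f m) <= 2 * nrm (f l)]; compactness of the square turns these local bounds into one. *)
Lemma resolvent_bounded w f (r : R) : resolvent w f ->
  exists K, forall x y : R, `|x| <= r -> `|y| <= r -> nrm (f (x +i* y)%C) <= K.
Proof.
move=> Hf.
have cpt : compact (`[-r, r]%classic `*` `[-r, r]%classic : set (R * R)).
  by apply: compact_setX; exact: segment_compact.
have /compact_near_coveringP cov := cpt.
have [|K [_ HK]] := cov R (pinfty_nbhs R) (fun K p => nrm (f (p.1 +i* p.2)%C) <= K) _.
  move=> [x y] _; set l := (x +i* y)%C.
  (* The ball of radius [d] has modulus radius at most [2 * d], and
     [2 * d * (nrm (f l) * nrm w) <= 2^-1]; the [+ 1] keeps the denominator positive. *)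
  pose d := 4^-1 / (nrm (f l) * nrm w + 1).
  have c0 : 0 < nrm (f l) * nrm w + 1 by rewrite ltr_wpDl ?mulr_ge0.
  have d0 : 0 < d by rewrite divr_gt0 ?invr_gt0.
  exists (ball (x, y) d, [set K | 2 * nrm (f l) < K]%classic).
    split=> /=; first exact: nbhsx_ballx.
    by exists (2 * nrm (f l)); split; [exact: num_real|].
  move=> [[x' y'] K] /= [[hx hy] hK]; set m := (x' +i* y')%C.
  have hd : normc (m - l) <= 2 * d.
    have h1 := normc_rect (x' - x) (y' - y).
    have -> : m - l = ((x' - x) +i* (y' - y))%C by [].
    move: hx hy; rewrite /ball /= distrC => hx; rewrite distrC => hy.
    by apply: le_trans h1 _; lra.
  have h := resolvent_sub_le l m Hf.
  have h2 : normc (m - l) * (nrm (f l) * nrm w) <= 2^-1.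
    apply: le_trans (ler_wpM2r _ hd) _; first by rewrite mulr_ge0.
    have hc : d * (nrm (f l) * nrm w + 1) = 4^-1 by rewrite mulfVK ?lt0r_neq0.
    lra.
  rewrite mulrA in h; have := ler_wpM2r (bge0 (f m)) h2.
  have := bnrm_leD hB (f m - f l) (f l); rewrite subrK; lra.
exists (K + 1) => x y xr yr; apply: (HK (K + 1) _ (x, y)).
  by rewrite ltrDl.
by rewrite /= !in_itv /= -!ler_norml.
Qed.

Definition lipschitz_on_disc (f : R[i] -> B) r L := forall l m,
  normc l <= r -> normc m <= r -> nrm (f m - f l) <= L * normc (m - l).

Lemma resolvent_lipschitz w f r : resolvent w f ->
  exists2 L, 0 <= L & lipschitz_on_disc f r L.
Proof.
move=> Hf; have [K HK] := resolvent_bounded r Hf.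
(* The maximum keeps the constant nonnegative even for negative [r], when the disc is empty. *)
pose K' := Num.max K 0.
have HK' l : normc l <= r -> nrm (f l) <= K'.
  case: l => x y lr; have [h1 h2] := rect_normc x y.
  by rewrite le_max HK ?(le_trans h1) ?(le_trans h2).
have K0 : 0 <= K' by rewrite le_max lexx orbT.
exists (K' * nrm w * K'); first by rewrite !mulr_ge0.
move=> l m lr mr; apply: le_trans (resolvent_sub_le l m Hf) _.
rewrite mulrC; apply: ler_wpM2r; first exact: normc_ge0.
by rewrite ler_pM ?mulr_ge0 ?ler_wpM2r ?HK'.
Qed.

Definition power_resolvent w n (g : R[i] -> B) := forall l,
  (1 - (s l * w) ^+ n) * g l = 1 /\ g l * (1 - (s l * w) ^+ n) = 1.

(* The Lipschitz constant does not grow with the exponent, because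
   1/(1 - y^2) is the average of 1/(1 - y) and 1/(1 + y), and passing from y to
   -y amounts to rotating l by a root of unity. *)
Lemma power_resolvent_lipschitz w f r L m : resolvent w f ->
  lipschitz_on_disc f r L ->
  exists2 g, power_resolvent w (2 ^ m) g & lipschitz_on_disc g r L.
Proof.
move=> Hf fL; elim: m => [|m [g Hg gL]]; first by exists f.
have [z [zm z1]] := @root_of_minus_one R m.
pose h l := s 2^-1 * (g l + g (z * l)).
have s2 : s 2^-1 * (1 + 1) = 1.
  have -> : 1 + 1 = s 2 :> B by rewrite rmorph_nat.
  by rewrite -rmorphM mulVf ?rmorph1 // pnatr_eq0.
exists h.
  move=> l; rewrite expnSr exprM expr2 /h; set y := (s l * w) ^+ (2 ^ m).
  have [g1 g2] := Hg l; have [g3 g4] := Hg (z * l).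
  have zl : (s (z * l) * w) ^+ (2 ^ m) = - y.
    rewrite rmorphM -mulrA exprMn_comm; last exact: (banach_central hB).
    by rewrite -rmorphXn zm rmorphN1 mulN1r.
  rewrite zl opprK in g3 g4; rewrite -/y in g1 g2.
  split.
    rewrite mulrA -(banach_central hB) -mulrA -[RHS]s2; congr (_ * _).
    have -> : (1 - y * y) * (g l + g (z * l)) =
      (1 + y) * ((1 - y) * g l) + (1 - y) * ((1 + y) * g (z * l)) by ncring.
    by rewrite g1 g3; ncring.
  rewrite -mulrA -[RHS]s2; congr (_ * _).
  have -> : (g l + g (z * l)) * (1 - y * y) =
    (g l * (1 - y)) * (1 + y) + (g (z * l) * (1 + y)) * (1 - y) by ncring.
  by rewrite g2 g4; ncring.
move=> l n lr nr; rewrite /h -mulrBr (banach_scale hB).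
have -> : normc (2^-1 : R[i]) = 2^-1.
  have -> : (2^-1 : R[i]) = (2^-1 : R)%:C%C by rewrite fmorphV rmorph_nat.
  by rewrite normcR ger0_norm // invr_ge0.
have h1 := gL l n lr nr.
have h2 : nrm (g (z * n) - g (z * l)) <= L * normc (n - l).
  rewrite -[normc (n - l)]mul1r -z1 -normcM mulrBr.
  by apply: gL; rewrite normcM z1 mul1r.
have -> : g n + g (z * n) - (g l + g (z * l)) =
  (g n - g l) + (g (z * n) - g (z * l)) by ncring.
have := bnrm_leD hB (g n - g l) (g (z * n) - g (z * l)); lra.
Qed.

(** From [g - 1 = y * (g - 1) + y], the norm [t] of [g - 1] satisfies [t <= t / 4 + 1 / 4]. *)
Lemma inverse_near_one y g : (1 - y) * g = 1 -> nrm y <= 4^-1 ->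
  nrm (g - 1) <= 3^-1.
Proof.
move=> yg y4; have e : g - 1 = y * (g - 1) + y.
  by rewrite -[X in g - X = _]yg; ncring.
have := bnrm_leD hB (y * (g - 1)) y; rewrite -e.
have := le_trans (bnrm_leM hB y (g - 1)) (ler_wpM2r (bge0 (g - 1)) y4); lra.
Qed.

(** From [y = (g - 1) - (g - 1) * y], the norm [t] of [y] satisfies [t <= 3 / 8 + 3 / 8 * t]. *)
Lemma one_sub_inverse_small y g : (1 - y) * g = 1 -> g * (1 - y) = 1 ->
  nrm (g - 1) <= 3 / 8 -> nrm y <= 3 / 5.
Proof.
move=> yg gy g1; have e : y = (g - 1) - (g - 1) * y.
  have -> : (g - 1) - (g - 1) * y = g * (1 - y) - 1 + y by ncring.
  by rewrite gy; ncring.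
have := bnrm_leB hB (g - 1) ((g - 1) * y); rewrite -e.
have := le_trans (bnrm_leM hB (g - 1) y) (ler_wpM2r (bge0 y) g1); lra.
Qed.

(** As [L] does not depend on [m], the step length [d] does not either. The distance of [g] from 1
    grows from 1/3 to at most 1/3 + 1/24 = 3/8, so the power has norm at most 3/5 at [t + d]; its
    fourth power, of exponent [2 ^ (m + 2)], is again below 1/4. *)
Lemma power_small_step w f r L t d m : resolvent w f ->
  lipschitz_on_disc f r L -> 0 <= L -> 0 <= t -> 0 <= d -> t + d <= r ->
  L * d <= 24^-1 -> nrm ((s t%:C%C * w) ^+ (2 ^ m)) <= 4^-1 ->
  nrm ((s (t + d)%:C%C * w) ^+ (2 ^ (m + 2))) <= 4^-1.
Proof.
move=> Hf fL L0 t0 d0 tdr Ld hm.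
have [g Hg gL] := power_resolvent_lipschitz m Hf fL.
have [g1 _] := Hg t%:C%C; have [g3 g4] := Hg (t + d)%:C%C.
have h1 := inverse_near_one g1 hm.
have h2 : nrm (g (t + d)%:C%C - g t%:C%C) <= 24^-1.
  apply: le_trans (gL _ _ _ _) _; rewrite ?normcR ?ger0_norm ?addr_ge0 //; first lra.
  by rewrite -rmorphB normcR addrC addKr ger0_norm.
have h3 : nrm (g (t + d)%:C%C - 1) <= 3 / 8.
  have := bnrm_le_distD hB (g t%:C%C) (g (t + d)%:C%C) 1; lra.
have h4 := one_sub_inverse_small g3 g4 h3.
rewrite expnD exprM; apply: le_trans (bnrm_leX hB _ _) _ => //.
apply: (@le_trans _ _ ((3 / 5) ^+ 4)); last by lra.
apply: lerXn2r => //; rewrite nnegrE //; lra.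
Qed.

(* The spectral radius formula for spectrum {0}. *)
Lemma quasinilpotent_power_small w e : quasinilpotent w -> 0 < e ->
  exists2 n, (0 < n)%N & nrm (w ^+ n) <= 4^-1 * e ^+ n.
Proof.
move=> /resolvent_exists[f Hf] e0; pose r := e^-1.
have r0 : 0 < r by rewrite invr_gt0.
have [L L0 fL] := resolvent_lipschitz r Hf.
(* Steps of length [d = r / k] satisfy [L * d <= 24^-1], and [k] of them lead from 0, where the
   power vanishes, to [r]. *)
pose k := Num.bound (24 * L * r).
have kb : 24 * L * r < k%:R by apply: archi_boundP; rewrite !mulr_ge0 // ltW.
have k0 : 0 < k%:R :> R by apply: le_lt_trans kb; rewrite !mulr_ge0 // ltW.
pose d := r / k%:R.
have d0 : 0 <= d by rewrite divr_ge0 // ltW.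
have dk : d * k%:R = r by rewrite mulfVK // lt0r_neq0.
have Ld : L * d <= 24^-1.
  rewrite mulrA ler_pdivrMr //; lra.
have H j : (j <= k)%N -> exists m, nrm ((s (d * j%:R)%:C%C * w) ^+ (2 ^ m)) <= 4^-1.
  elim: j => [_|j IH jk].
    by exists 0%N; rewrite mulr0 rmorph0 mul0r (bnrm0 hB) // invr_ge0.
  have [m hm] := IH (ltnW jk); exists (m + 2)%N.
  rewrite -natr1 mulrDr mulr1.
  apply: (power_small_step Hf fL L0 _ d0 _ Ld hm).
    exact: (mulr_ge0 d0 (ler0n _ _)).
  rewrite -dk -[X in _ + X]mulr1 -mulrDr natr1; apply: ler_wpM2l => //.
  by rewrite ler_nat.
(* At radius [r = e^-1] the bound on the power of [s r%:C%C * w] is the claim divided by [e ^+ n],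
   with [n = 2 ^ m]. *)
have [m hm] := H k (leqnn k); exists (2 ^ m)%N; first by rewrite expn_gt0.
move: hm; rewrite dk exprMn_comm; last exact: (banach_central hB).
rewrite -rmorphXn (banach_scale hB) normcX normcR gtr0_norm // /r exprVn.
by rewrite mulrC ler_pdivrMr // exprn_gt0.
Qed.

End SpectralRadius.

(** * Quasinilpotent elements in terms of norms *)

Section GpiHirano.
Variables (R : realType) (B : nzRingType) (s : {rmorphism R[i] -> B}).
Variables (nrm : B -> R) (hB : banach_over_complex s nrm).
Implicit Types x y z w : B.
Let bge0 := bnrm_ge0 hB.
Hint Resolve bge0 : core.
Notation quasinilpotent := (quasinilpotent s).

Lemma comm_scalar l x : GRing.comm x (s l).
Proof. by rewrite /GRing.comm (banach_central hB). Qed.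
Hint Resolve comm_scalar : core.

Lemma exprM_scalar l x n : (s l * x) ^+ n = s (l ^+ n) * x ^+ n.
Proof. by rewrite exprMn_comm ?rmorphXn //; apply: commr_sym. Qed.

(** The norm form is what multiplication by a commuting element preserves. Conversely,
    [e = (normc l + 1)^-1] gives some power of [s l * w] norm at most 1/4, and the Neumann series
    applies to it. *)
Lemma quasinilpotentP w : quasinilpotent w <->
  forall e, 0 < e -> exists2 n, (0 < n)%N & nrm (w ^+ n) <= 4^-1 * e ^+ n.
Proof.
split=> [qw e|H l]; first exact: (quasinilpotent_power_small hB).
have l0 := normc_ge0 l; have l1 : 0 < normc l + 1 by lra.
have [|n n0 hn] := H (normc l + 1)^-1; first by rewrite invr_gt0.
apply: (@invertible_1subX_small _ _ _ _ hB _ n).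
rewrite exprM_scalar (banach_scale hB) normcX.
apply: le_trans (ler_wpM2l (exprn_ge0 _ l0) hn) _.
rewrite mulrCA -exprMn.
have : (normc l * (normc l + 1)^-1) ^+ n <= 1.
  by rewrite exprn_ile1 ?mulr_ge0 ?invr_ge0 ?(ltW l1) // ler_pdivrMr // mul1r lerDl.
lra.
Qed.

Lemma quasinilpotentM v z : quasinilpotent v -> GRing.comm v z -> quasinilpotent (v * z).
Proof.
move=> /quasinilpotentP Hv vz; apply/quasinilpotentP => e e0.
have z1 : 0 < nrm z + 1 by have := bge0 z; lra.
have [|n n0 hn] := Hv (e / (nrm z + 1)); first by rewrite divr_gt0.
exists n => //; rewrite exprMn_comm //; apply: le_trans (bnrm_leM hB _ _) _.
apply: le_trans (ler_pM _ _ hn (bnrm_leX hB z n0)) _ => //.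
rewrite -mulrA -exprMn; apply: ler_wpM2l; first by rewrite invr_ge0.
have ez : 0 <= e / (nrm z + 1) * nrm z by rewrite !mulr_ge0 ?invr_ge0 // ltW.
apply: lerXn2r; rewrite ?nnegrE ?(ltW e0) //.
rewrite mulrAC ler_pdivrMr // ler_wpM2l ?ltW //; lra.
Qed.

Lemma quasinilpotentX y n : quasinilpotent (y ^+ n) -> quasinilpotent y.
Proof.
by move=> H l; apply: (@invertible_1subX _ _ n); rewrite exprM_scalar.
Qed.

(** With an inverse [y], some product [w ^+ n * y ^+ n = 1] would have norm at most 1/4, whereas
    [1 <= nrm 1]. *)
Lemma quasinilpotent_not_invertible w : quasinilpotent w -> ~ invertible w.
Proof.
move=> /quasinilpotentP Hw [y [wy yw]].
have y1 : 0 < nrm y + 1 by have := bge0 y; lra.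
have [|n n0 hn] := Hw (nrm y + 1)^-1; first by rewrite invr_gt0.
have e1 : w ^+ n * y ^+ n = 1.
  by rewrite -exprMn_comm ?wy ?expr1n // /GRing.comm wy yw.
have := bnrm_leM hB (w ^+ n) (y ^+ n); rewrite e1.
have := ler_pM (bge0 _) (bge0 _) hn (bnrm_leX hB y n0).
rewrite -mulrA -exprMn.
have : ((nrm y + 1)^-1 * nrm y) ^+ n <= 1.
  rewrite exprn_ile1 ?mulr_ge0 ?invr_ge0 ?(ltW y1) // mulrC ler_pdivrMr // mul1r.
  by rewrite lerDl.
have := bnrm1_ge1 hB; lra.
Qed.

Lemma qnilP w : qnil s w <-> quasinilpotent w.
Proof.
split=> [H l|H l].
  have [->|l0] := eqVneq l 0.
    by rewrite rmorph0 mul0r subr0; exact: invertible1.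
  have -> : 1 - s l * w = s l * (s l^-1 - w).
    by rewrite mulrBr -rmorphM mulfV // rmorph1.
  apply: invertible_scale => //; apply: contrapT => /H /eqP.
  by rewrite invr_eq0 (negbTE l0).
split=> [|-> ]; last first.
  rewrite /spectrum rmorph0 sub0r => /invertibleN; rewrite opprK.
  exact: quasinilpotent_not_invertible.
apply: contra_notP => /eqP l0.
have -> : s l - w = s l * (1 - s l^-1 * w).
  by rewrite mulrBr mulr1 mulrA -rmorphM mulfV // rmorph1 mul1r.
exact: invertible_scale.
Qed.

(** * A quadratic equation solved by iteration in a weighted norm *)

Section WeightedNorm.
Variables (c : B) (N : nat).
Hypotheses (N0 : (0 < N)%N) (cN : nrm (c ^+ N) <= 8^-1 ^+ N).

(* An equivalent norm for which left multiplication by c has norm at most 1/8. *)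
Definition wnrm z := \sum_(m < N) 8 ^+ m * nrm (c ^+ m * z).

Lemma wnrm_ge0 z : 0 <= wnrm z.
Proof. by apply: sumr_ge0 => m _; rewrite mulr_ge0 // exprn_ge0. Qed.

Lemma wnrm_ge z : nrm z <= wnrm z.
Proof.
rewrite /wnrm; case: N N0 => // n _; rewrite big_ord_recl expr0 mul1r expr0 mul1r.
by rewrite lerDl; apply: sumr_ge0 => m _; rewrite mulr_ge0 // exprn_ge0.
Qed.

Lemma wnrm_leD y z : wnrm (y + z) <= wnrm y + wnrm z.
Proof.
rewrite /wnrm -big_split /=; apply: ler_sum => m _.
rewrite -mulrDr; apply: ler_wpM2l; first by rewrite exprn_ge0.
by rewrite mulrDr; exact: (bnrm_leD hB).
Qed.

Lemma wnrmN z : wnrm (- z) = wnrm z.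
Proof. by apply: eq_bigr => m _; rewrite mulrN (bnrmN hB). Qed.

Definition wbounded y K := forall z, wnrm (y * z) <= K * wnrm z.

(** Multiplying by [c] shifts the sum by one index, at the price of a factor 1/8; the new top term
    [8 ^+ N * nrm (c ^+ N * z)] is at most the lost bottom term [nrm z] by [cN]. *)
Lemma wbounded_c : wbounded c 8^-1.
Proof.
move=> z; have -> : wnrm (c * z) =
    8^-1 * \sum_(m < N) 8 ^+ m.+1 * nrm (c ^+ m.+1 * z).
  rewrite /wnrm mulr_sumr; apply: eq_bigr => m _.
  by rewrite exprS [c ^+ m.+1]exprSr -!mulrA mulKf // pnatr_eq0.
apply: ler_wpM2l; first by rewrite invr_ge0.
rewrite -(lerD2l (8 ^+ 0 * nrm (c ^+ 0 * z))).
rewrite -(big_ord_recl N (fun m : 'I_N.+1 => 8 ^+ m * nrm (c ^+ m * z))) big_ord_recr /=.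
rewrite addrC lerD2r expr0 mul1r expr0 mul1r.
apply: le_trans (ler_wpM2l _ (bnrm_leM hB _ _)) _; first by rewrite exprn_ge0.
rewrite mulrA -[X in _ <= X]mul1r; apply: ler_wpM2r => //.
apply: le_trans (ler_wpM2l _ cN) _; first by rewrite exprn_ge0.
by rewrite -exprMn mulfV ?pnatr_eq0 // expr1n.
Qed.

Lemma wboundedW y K K' : K <= K' -> wbounded y K -> wbounded y K'.
Proof.
by move=> KK H z; apply: le_trans (H z) _; apply: ler_wpM2r => //; exact: wnrm_ge0.
Qed.

Lemma wboundedM x y K K' : 0 <= K -> wbounded x K -> wbounded y K' ->
  wbounded (x * y) (K * K').
Proof.
move=> K0 Hx Hy z; rewrite -!mulrA; apply: le_trans (Hx _) _.
exact: ler_wpM2l.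
Qed.

Lemma wboundedD x y K K' : wbounded x K -> wbounded y K' -> wbounded (x + y) (K + K').
Proof.
move=> Hx Hy z; rewrite !mulrDl; apply: le_trans (wnrm_leD _ _) _.
exact: lerD.
Qed.

Lemma wboundedN x K : wbounded x K -> wbounded (- x) K.
Proof. by move=> Hx z; rewrite mulNr wnrmN. Qed.

Lemma wbounded1 : wbounded 1 1.
Proof. by move=> z; rewrite !mul1r. Qed.

Lemma wbounded_nrm y K : wbounded y K -> nrm y <= K * wnrm 1.
Proof. by move=> /(_ 1); rewrite mulr1; apply: le_trans; exact: wnrm_ge. Qed.

Fixpoint quadratic_iter k : B :=
  if k is k'.+1 then 1 - c * (quadratic_iter k' * quadratic_iter k') else 1.

(** The bound 2 reproduces itself, since [1 + 8^-1 * (2 * 2) <= 2]. *)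
Lemma quadratic_iter_bound k : wbounded (quadratic_iter k) 2.
Proof.
elim: k => [|k IH] /=.
  by apply: wboundedW wbounded1; lra.
apply: (@wboundedW _ (1 + 8^-1 * (2 * 2))); first lra.
apply: wboundedD; first exact: wbounded1.
apply/wboundedN/wboundedM; [by rewrite invr_ge0|exact: wbounded_c|].
exact: wboundedM.
Qed.

(** A difference of squares is [t1 * (t1 - t0) + (t1 - t0) * t0], so the iteration contracts by
    [8^-1 * (2 + 2) = 2^-1]. *)
Lemma quadratic_iter_sub k :
  wbounded (quadratic_iter k.+1 - quadratic_iter k) (2^-1 ^+ k).
Proof.
elim: k => [|k IH].
  rewrite /= !mulr1 addrAC subrr add0r expr0.
  apply/wboundedN; apply: (@wboundedW _ 8^-1); [lra|exact: wbounded_c].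
have b1 := quadratic_iter_bound k.+1; have b0 := quadratic_iter_bound k.
set t1 := quadratic_iter k.+1 in IH b1 *; set t0 := quadratic_iter k in IH b0 *.
have -> : quadratic_iter k.+2 - t1 = - (c * (t1 * (t1 - t0) + (t1 - t0) * t0)).
  have t1E : t1 = 1 - c * (t0 * t0) by [].
  have -> : quadratic_iter k.+2 = 1 - c * (t1 * t1) by [].
  by rewrite [X in _ - X = _]t1E; ncring.
have h0 : 0 <= 2^-1 ^+ k :> R by rewrite exprn_ge0 // invr_ge0.
rewrite exprS; set q := 2^-1 ^+ k in IH h0 *.
apply: (@wboundedW _ (8^-1 * (2 * q + q * 2))); first lra.
apply/wboundedN/wboundedM; [by rewrite invr_ge0|exact: wbounded_c|].
by apply: wboundedD; exact: wboundedM.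
Qed.

Lemma quadratic_fixpoint_weighted : exists t, t = 1 - c * (t * t) /\
  forall x, GRing.comm x c -> GRing.comm x t.
Proof.
have Hk k : nrm (quadratic_iter k.+1 - quadratic_iter k) <= wnrm 1 * 2^-1 ^+ k.
  by rewrite mulrC; apply: wbounded_nrm; exact: quadratic_iter_sub.
have [t Ht] := geometric_limit hB Hk; exists t.
have h k : 0 <= 2^-1 ^+ k :> R by rewrite exprn_ge0 // invr_ge0.
pose D := 2 * wnrm 1.
split.
  apply/subr0_eq/(bnrm_eq0 hB).
  apply: (@half_exp_le0 _ (D + nrm c * (nrm t * D + D * (2 * wnrm 1)))) => k.
  set u := quadratic_iter k.
  have -> : t - (1 - c * (t * t)) =
     (t - quadratic_iter k.+1) + c * (t * (t - u) + (t - u) * u).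
    by rewrite /= -/u; ncring.
  have h1 := Ht k.+1; have h2 := Ht k.
  rewrite (bnrm_distC hB) exprS in h1; rewrite (bnrm_distC hB) -/u -/D in h2.
  have h3 : nrm u <= 2 * wnrm 1 by apply/wbounded_nrm/quadratic_iter_bound.
  apply: le_trans (bnrm_leD hB _ _) _; rewrite [X in _ <= X]mulrDl; apply: lerD.
    apply: le_trans h1 _; rewrite -/D mulrCA; have : 0 <= D * 2^-1 ^+ k.
      by rewrite mulr_ge0 // mulr_ge0 // wnrm_ge0.
    lra.
  apply: le_trans (bnrm_leM hB _ _) _; rewrite -mulrA; apply: ler_wpM2l => //.
  apply: le_trans (bnrm_leD hB _ _) _; rewrite [X in _ <= X]mulrDl; apply: lerD.
    by apply: le_trans (bnrm_leM hB _ _) _; rewrite -mulrA; exact: ler_wpM2l.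
  by apply: le_trans (bnrm_leM hB _ _) _; rewrite mulrAC; exact: ler_pM.
(* The iterates are polynomials in [c], so [x] commutes with each of them, and then with the
   limit. *)
move=> x xc; have xk k : GRing.comm x (quadratic_iter k).
  elim: k => [|k IH] /=; first exact: commr1.
  by apply: commrB; [exact: commr1|apply: commrM => //; exact: commrM].
apply/subr0_eq/(bnrm_eq0 hB).
apply: (@half_exp_le0 _ (nrm x * D + D * nrm x)) => k.
set u := quadratic_iter k.
have -> : x * t - t * x = x * (t - u) - (t - u) * x.
  have := xk k; rewrite /GRing.comm -/u => xu.
  by rewrite mulrBr mulrBl xu; ncring.
have h2 := Ht k; rewrite (bnrm_distC hB) -/u -/D in h2.
apply: le_trans (bnrm_leB hB _ _) _; rewrite [X in _ <= X]mulrDl; apply: lerD.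
  by apply: le_trans (bnrm_leM hB _ _) _; rewrite -mulrA; exact: ler_wpM2l.
by apply: le_trans (bnrm_leM hB _ _) _; rewrite mulrAC; exact: ler_wpM2r.
Qed.

End WeightedNorm.

(** * Lifting idempotents modulo quasinilpotent elements *)

Lemma quadratic_fixpoint c : quasinilpotent c -> exists t, t = 1 - c * (t * t) /\
  forall x, GRing.comm x c -> GRing.comm x t.
Proof.
move=> /quasinilpotentP /(_ 8^-1) [|N N0 hN]; first by rewrite invr_gt0.
apply: (quadratic_fixpoint_weighted N0); apply: le_trans hN _.
have : 0 <= 8^-1 ^+ N :> R by rewrite exprn_ge0 // invr_ge0.
lra.
Qed.

(** With [v = e - e * e] and [u = e + e - 1], the element [p = e + v * z] has [p * p - p = v * (-1 +
    u * z + v * (z * z))]. As [u * u = 1 - s 4 * v] has an inverse [i], the choice [z = u * i * t],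
    which is [u^-1 * t], turns the vanishing of the bracket into [t = 1 - v * i * (t * t)], with
    [v * i] quasinilpotent. *)
Lemma lift_idempotent e : quasinilpotent (e - e * e) ->
  exists p z, [/\ p * p = p, p = e + (e - e * e) * z &
    forall x, GRing.comm x e -> GRing.comm x z].
Proof.
set v := e - e * e => qv; set u := e + e - 1.
have uu : u * u = 1 - s 4 * v.
  have -> : s 4 = 1 + 1 + 1 + 1 by rewrite rmorph_nat !mulrSr mulr0n add0r.
  by rewrite /u /v; ncring.
have [i [ui iu]] := qv 4; rewrite -uu in ui iu.
have com_v x : GRing.comm x e -> GRing.comm x v.
  by move=> xe; apply: commrB => //; exact: commrM.
have com_u x : GRing.comm x e -> GRing.comm x u.
  by move=> xe; apply: commrB; [exact: commrD|exact: commr1].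
have com_i x : GRing.comm x e -> GRing.comm x i.
  by move=> xe; apply: comm_inverse ui iu _; apply: commrM; exact: com_u.
have ev : GRing.comm v e by apply/commr_sym/com_v.
have qc : quasinilpotent (v * i) by apply: quasinilpotentM => //; exact: com_i.
have [t [tE tC]] := quadratic_fixpoint qc.
have com_t x : GRing.comm x e -> GRing.comm x t.
  by move=> xe; apply: tC; apply: commrM; [exact: com_v|exact: com_i].
have com_z x : GRing.comm x e -> GRing.comm x (u * i * t).
  by move=> xe; apply: commrM; [apply: commrM; [exact: com_u|exact: com_i]|exact: com_t].
set z := u * i * t in com_z.
have ez : e * z = z * e by exact: com_z.
have vz : z * v = v * z by apply: com_v; apply: commr_sym.
have ve : e * v = v * e by [].
exists (e + v * z), z; split=> //.
have uz : u * z = t by rewrite /z !mulrA ui mul1r.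
have vzz : v * (z * z) = v * i * (t * t).
  have tu : t * u = u * t by apply: com_u; apply: commr_sym; exact: com_t.
  have iu' : i * u = u * i by apply: com_u; apply: commr_sym; exact: com_i.
  have ti : t * i = i * t by apply: com_i; apply: commr_sym; exact: com_t.
  rewrite -[RHS]mulrA; congr (v * _); rewrite /z.
  have -> : u * i * t * (u * i * t) = u * i * (t * u) * i * t by ncring.
  rewrite tu; have -> : u * i * (u * t) * i * t = u * (i * u) * (t * i) * t by ncring.
  rewrite iu' ti; have -> : u * (u * i) * (i * t) * t = (u * u * i) * i * (t * t) by ncring.
  by rewrite ui mul1r.
apply/subr0_eq.
have -> : (e + v * z) * (e + v * z) - (e + v * z) =
  (e * e - e) + (e * v) * z + v * (z * e) - v * z + v * (z * v) * z by ncring.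
rewrite vz ve -ez.
have -> : e * e - e = - v by rewrite /v opprB.
have -> : - v + v * e * z + v * (e * z) - v * z + v * (v * z) * z =
  v * (- 1 + (e + e - 1) * z + v * (z * z)) by ncring.
rewrite -/u uz vzz.
have -> : -1 + t + v * i * (t * t) = t - (1 - v * i * (t * t)) by ncring.
by rewrite -tE subrr mulr0.
Qed.

(** * Polynomials in an element and the spectral criterion *)

Definition unity_spectrum n a := forall l, l ^+ n.+1 != l -> invertible (s l - a).

Section Evaluation.
Variable a : B.

Lemma comm_scalars : commr_rmorph s a.
Proof. by move=> l; exact: comm_scalar. Qed.

Notation ev := (horner_morph comm_scalars).

(** Over the complex numbers [q] splits into linear factors, whose values at [a] are invertible. *)
Lemma invertible_horner (q : {poly R[i]}) : q != 0 ->
  (forall r, root q r -> invertible (s r - a)) -> invertible (ev q).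
Proof.
move=> q0; have [rs ->] := closed_field_poly_normal q => H.
have lq : lead_coef q != 0 by rewrite lead_coef_eq0.
rewrite -mul_polyC rmorphM /= horner_morphC; apply: invertible_scale => //.
have {H} : forall r, r \in rs -> invertible (s r - a).
  by move=> r rrs; apply: H; rewrite rootZ // root_prod_XsubC.
elim: rs => [_|r rs IH H]; first by rewrite big_nil rmorph1; exact: invertible1.
rewrite big_cons rmorphM; apply: invertibleM.
  rewrite rmorphB /= horner_morphX horner_morphC -opprB; apply: invertibleN.
  by apply: H; rewrite mem_head.
by apply: IH => x xrs; apply: H; rewrite inE xrs orbT.
Qed.

(** A root [r] of [1 - l%:P * f] has [f.[r]] nonzero, so [r ^+ n.+1] differs from [r] and [s r - a]
    is invertible. *)
Lemma quasinilpotent_horner n (f : {poly R[i]}) : unity_spectrum n a ->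
  (forall r, r ^+ n.+1 = r -> f.[r] = 0) -> quasinilpotent (ev f).
Proof.
move=> Ha Hf l.
have -> : 1 - s l * ev f = ev (1 - l%:P * f).
  by rewrite rmorphB rmorphM rmorph1 /= horner_morphC.
apply: invertible_horner.
  (* The polynomial takes the value 1 at 0, because [f] vanishes there. *)
  apply/negP => /eqP /(congr1 (fun q => q.[0])).
  by rewrite !hornerE Hf ?expr0n // mulr0 subr0 => /eqP; rewrite oner_eq0.
move=> r; rewrite rootE hornerD hornerN hornerM !hornerC subr_eq0 => /eqP lf.
apply: Ha; apply/eqP => rn; move/eqP: lf.
by rewrite Hf // mulr0 oner_eq0.
Qed.

End Evaluation.

(** The required element is the inverse of [a] on the corner of an idempotent [p] lifted from
    [a ^+ n], and 0 on the corner of [1 - p]. *)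
Lemma gpi_hirano_of_unity_spectrum n a :
  (0 < n)%N -> unity_spectrum n a -> gpi_hirano s a.
Proof.
move=> n0 Ha.
have qw : quasinilpotent (a - a ^+ n.+1).
  have -> : a - a ^+ n.+1 = horner_morph (comm_scalars a) ('X - 'X^(n.+1)).
    by rewrite rmorphB rmorphXn /= horner_morphX.
  by apply: quasinilpotent_horner Ha _ => r rn; rewrite hornerD hornerN hornerX hornerXn rn subrr.
have qv : quasinilpotent (a ^+ n - a ^+ n * a ^+ n).
  have -> : a ^+ n - a ^+ n * a ^+ n = horner_morph (comm_scalars a) ('X^n - 'X^n * 'X^n).
    by rewrite rmorphB rmorphM rmorphXn /= horner_morphX.
  apply: quasinilpotent_horner Ha _ => r rn.
  rewrite hornerD hornerN hornerM hornerXn.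
  have [->|r0] := eqVneq r 0; first by rewrite expr0n (gtn_eqF n0) mul0r subr0.
  have -> : r ^+ n = 1 by apply: (mulfI r0); rewrite -exprS rn mulr1.
  by rewrite mulr1 subrr.
have [p [z [pp pE zC]]] := lift_idempotent qv.
set e := a ^+ n in qv pE zC; set v := e - e * e in qv pE.
have ae : GRing.comm a e by exact: commrX.
have az : GRing.comm a z by exact: zC.
have av : GRing.comm a v by apply: commrB => //; exact: commrM.
have ap : GRing.comm a p by rewrite pE; apply: commrD => //; exact: commrM.
have ve : GRing.comm v e.
  by apply: commr_sym; apply: commrB => //; exact: commrM.
have vz : GRing.comm v z by exact: zC.
have ez : GRing.comm e z by exact: zC.
have vp : GRing.comm v p by rewrite pE; apply: commrD => //; exact: commrM.
have pe : p * e = e * p by apply/commr_sym; rewrite pE; apply: commrD => //; apply: commrM => //; exact: commr_sym.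
have qvp y : GRing.comm v y -> quasinilpotent (v * y) by exact: quasinilpotentM.
(* By [fE] the inverted element is [e] on the corner of [p] and 1 on the other, so [k] inverts
   [a ^+ n] on the corner of [p]. *)
have [k [fk kf]] : invertible (1 - v * (z * p)).
  by have := qvp (z * p) (commrM vz vp) 1; rewrite rmorph1 mul1r.
have vzE : v * z = p - e by rewrite pE addrAC subrr add0r.
have fE : 1 - v * (z * p) = 1 - p + e * p.
  by rewrite mulrA vzE mulrBl pp opprB addrA addrAC.
have ak : GRing.comm a k.
  apply: comm_inverse fk kf _; rewrite fE; apply: commrD.
    by apply: commrB => //; exact: commr1.
  exact: commrM.
have pk : GRing.comm p k.
  apply: comm_inverse fk kf _; rewrite fE; apply: commrD.
    by apply: commrB => //; exact: commr1.
  exact: commrM.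
have axp : a * (a ^+ n.-1 * p * k) = p.
  have -> : a * (a ^+ n.-1 * p * k) = e * p * k.
    by rewrite /e -[in RHS](prednK n0) exprS !mulrA.
  have -> : e * p = p * (1 - v * (z * p)).
    rewrite fE; have -> : p * (1 - p + e * p) = p - p * p + (p * e) * p by ncring.
    by rewrite pp pe subrr add0r -mulrA pp.
  by rewrite -mulrA fk mulr1.
have ax : GRing.comm a (a ^+ n.-1 * p * k).
  by apply: commrM => //; apply: commrM => //; exact: commrX.
set x := a ^+ n.-1 * p * k in axp ax.
have px : p * x = x.
  rewrite /x; have -> : p * (a ^+ n.-1 * p * k) = (p * a ^+ n.-1) * p * k by ncring.
  have -> : p * a ^+ n.-1 = a ^+ n.-1 * p by apply: commrX; exact: commr_sym.
  by rewrite -!mulrA (mulrA p) pp.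
exists x; split=> //.
  by rewrite -ax axp.
exists n; split=> //.
apply/qnilP.
have -> : a ^+ (n + 2) * x = a ^+ n.+1 * p.
  by rewrite addn2 exprSr -mulrA axp.
(* Its [n]-th power [e * (1 - p)] is a multiple of [v], because [e = p - v * z] and [p] is killed by
   [1 - p]. *)
have q1p : quasinilpotent (a * (1 - p)).
  apply: (@quasinilpotentX _ n); rewrite exprMn_comm; last first.
    by apply: commrB => //; exact: commr1.
  have -> : (1 - p) ^+ n = 1 - p.
    rewrite -(prednK n0); elim: n.-1 => [|m IH]; first by rewrite expr1.
    rewrite exprS IH; have -> : (1 - p) * (1 - p) = 1 - p - p + p * p by ncring.
    by rewrite pp subrK.
  have -> : a ^+ n * (1 - p) = v * (- (z * (1 - p))).
    rewrite mulrN mulrA vzE -/e.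
    have -> : - ((p - e) * (1 - p)) = e * (1 - p) - p + p * p by ncring.
    by rewrite pp subrK.
  apply: qvp; apply: commrN; apply: commrM => //.
  by apply: commrB => //; exact: commr1.
have pa := commr_sym ap.
have pan : GRing.comm p (a ^+ n.+1) by exact: commrX.
have sc y l : GRing.comm p y -> GRing.comm p (1 - s l * y).
  by move=> py; apply: commrB; [exact: commr1|exact: commrM].
have p1p : p * (1 - p) = 0 by rewrite mulrBr mulr1 pp subrr.
(* The element [a - a ^+ n.+1 * p] acts as [a - a ^+ n.+1] on the corner of [p] and as [a * (1 - p)]
   on the other; both are quasinilpotent. *)
move=> l; apply: (invertible_corners (p := p) (u := 1 - s l * (a - a ^+ n.+1))
  (v := 1 - s l * (a * (1 - p)))) => //.
- by apply: sc; apply: commrB => //; exact: commrM.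
- by apply: sc; apply: commrB.
- by apply: sc; apply: commrM => //; apply: commrB => //; exact: commr1.
- rewrite !mulrBl -!mulrA !mulrBl; rewrite -mulrA pp; ncring.
have e1 : (1 - p) * (1 - p) = 1 - p by rewrite mulrBl mul1r p1p subr0.
rewrite ![(1 - _) * (1 - p)]mulrBl -!mulrA e1; congr (_ - s l * _).
by rewrite mulrBl -mulrA p1p mulr0 subr0.
Qed.

(** With [p = a * x], the quasinilpotent [w] is [a - a ^+ n.+1] on the corner of [p] and [a] on the
    other. There [s l - a] divides [s (l - l ^+ n.+1) - w], respectively equals [s l - w], and both
    scalars are nonzero. *)
Lemma unity_spectrum_of_gpi_hirano a :
  gpi_hirano s a -> exists2 n, (0 < n)%N & unity_spectrum n a.
Proof.
move=> [x [xax ax [n [n0 /qnilP qw]]]]; exists n => // l ln.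
set w := a - a ^+ (n + 2) * x in qw; pose p := a * x.
have pp : p * p = p by rewrite /p -mulrA (mulrA x) xax.
have ap : GRing.comm a p by apply: commrM.
have pa := commr_sym ap.
have aw : a ^+ (n + 2) * x = a ^+ n.+1 * p by rewrite addn2 exprSr -mulrA.
have pw : GRing.comm p w.
  by rewrite /w aw; apply: commrB => //; apply: commrM => //; exact: commrX.
have inv_w m : m != 0 -> invertible (s m - w).
  move=> m0; have -> : s m - w = s m * (1 - s m^-1 * w).
    by rewrite mulrBr mulr1 mulrA -rmorphM mulfV // rmorph1 mul1r.
  exact: invertible_scale.
have l0 : l != 0 by apply: contra ln => /eqP ->; rewrite expr0n.
pose S := \sum_(i < n.+1) s l ^+ (n.+1.-1 - i) * a ^+ i.
have HS : s l ^+ n.+1 - a ^+ n.+1 = (s l - a) * S.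
  by apply: subrXX_comm; exact: commr_sym.
have comS y : GRing.comm y a -> GRing.comm y S.
  move=> ya; apply: commr_sum => i _.
  by apply: commrM; apply: commrX.
(* The cofactor [q] is [1 - S] on the corner of [p], where [X * (1 - S) = s l - s l ^+ n.+1 - (a - a
   ^+ n.+1)], and 1 on the other. *)
pose X := s l - a; pose q := (1 - S) * p + (1 - p).
have comX y : GRing.comm y a -> GRing.comm y X by move=> ya; apply: commrB.
have com1S y : GRing.comm y a -> GRing.comm y (1 - S).
  by move=> ya; apply: commrB; [exact: commr1|exact: comS].
have pq : GRing.comm p q.
  apply: commrD; first by apply: commrM => //; exact: com1S.
  by apply: commrB => //; exact: commr1.
apply: (@invertible_comm_factor _ X q).
  apply: commrD.
    by apply: commrM; [apply: com1S|]; apply/commr_sym/comX => //.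
  apply: commrB; [exact: commr1|]; exact/commr_sym/comX.
pose m := l - l ^+ n.+1.
have m0 : m != 0 by rewrite subr_eq0 eq_sym.
have sm : s m = s l - s l ^+ n.+1 by rewrite rmorphB rmorphXn.
have p1p : p * (1 - p) = 0 by rewrite mulrBr mulr1 pp subrr.
have e1 : (1 - p) * (1 - p) = 1 - p by rewrite mulrBl mul1r p1p subr0.
have qp : q * p = (1 - S) * p.
  rewrite /q; have -> : ((1 - S) * p + (1 - p)) * p = (1 - S) * (p * p) + p - p * p by ncring.
  by rewrite pp addrK.
have q1p : q * (1 - p) = 1 - p.
  by rewrite /q mulrDl -mulrA p1p mulr0 add0r.
apply: (invertible_corners (p := p) (u := s m - w) (v := s l - w)) => //.
- by apply: commrM => //; exact: comX.
- by apply: commrB.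
- by apply: commrB.
- rewrite -mulrA qp mulrA /X mulrBr mulr1 -HS sm /w aw.
  have -> : (s l - s l ^+ n.+1 - (a - a ^+ n.+1 * p)) * p =
    (s l - s l ^+ n.+1 - a) * p + a ^+ n.+1 * (p * p) by ncring.
  by rewrite pp; ncring.
- rewrite -mulrA q1p /X /w aw !mulrBl -[_ * p * _]mulrA p1p mulr0 subr0 //.
all: by apply: inv_w.
Qed.

End GpiHirano.

(** * One-sided inverses at boundary points of the spectrum *)

Lemma ray_avoiding (R : realType) (F : seq R[i]) (l : R[i]) :
  exists M : R, forall t : R, 0 < t -> l + t%:C%C * (1 +i* M)%C \notin F.
Proof.
pose slope (z : R[i]) := `|complex.Im (z - l) / complex.Re (z - l)|.
have slope_ge0 z : 0 <= slope z by exact: normr_ge0.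
(* This slope exceeds that of every line from [l] to a point of [F]. A zero real part gives the
   default slope 0, but on the open ray the real part of [z - l] is [t > 0]. *)
exists (1 + \sum_(z <- F) slope z) => t t0; apply/negP => zF.
set M := 1 + _ in zF; set z := l + _ in zF.
have M0 : 0 <= M by rewrite addr_ge0 // sumr_ge0.
have zl : slope z = M.
  rewrite /slope /z addrC addKr /= !mul0r subr0 addr0 mulr1.
  by rewrite mulrAC mulfV ?mul1r ?lt0r_neq0 // ger0_norm.
have : slope z <= \sum_(z <- F) slope z.
  by rewrite (big_rem z) //= lerDl sumr_ge0.
by rewrite zl /M; lra.
Qed.

Section Boundary.
Variables (R : realType) (B : nzRingType) (s : {rmorphism R[i] -> B}).
Variables (nrm : B -> R) (hB : banach_over_complex s nrm).
Implicit Types x y z w : B.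
Let bge0 := bnrm_ge0 hB.
Hint Resolve bge0 : core.

Definition one_sided_inverse x y := x * y = 1 \/ y * x = 1.

Lemma invertible_near l m x y : (s l - x) * y = 1 -> y * (s l - x) = 1 ->
  normc (m - l) * nrm y <= 2^-1 -> invertible (s m - x).
Proof.
move=> ly yl h.
have [v [vy yv]] : invertible (1 - s (l - m) * y).
  apply: (invertible_1sub_small hB); rewrite (banach_scale hB).
  by rewrite -opprB (@normcN R).
have cy : s (l - m) * y = y * s (l - m) by exact: (banach_central hB).
have e1 : (s m - x) * y = 1 - s (l - m) * y.
  by rewrite -ly rmorphB; ncring.
have e2 : y * (s m - x) = 1 - s (l - m) * y.
  by rewrite cy -yl rmorphB; ncring.
apply: (@invertible_lr _ _ (y * v) (v * y)).
  by rewrite mulrA e1.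
by rewrite -mulrA e2.
Qed.

(** The product of [y] and [s m - x], taken in the order given by the side of the inverse, is near 1
    and so invertible. Since [s m - x] is invertible, [y] is too, and a one-sided inverse of an
    invertible element is two-sided. *)
Lemma invertible_limit l m x y : one_sided_inverse (s l - x) y ->
  normc (m - l) * nrm y <= 2^-1 -> invertible (s m - x) -> invertible (s l - x).
Proof.
move=> ly h [u [mu um]].
have [v [vy yv]] : invertible (1 - s (l - m) * y).
  apply: (invertible_1sub_small hB); rewrite (banach_scale hB).
  by rewrite -opprB (@normcN R).
case: ly => ly.
  have e1 : (s m - x) * y = 1 - s (l - m) * y.
    by rewrite -ly rmorphB; ncring.
  rewrite -e1 in vy yv.
  have yy : y * (v * (s m - x)) = 1.
    have -> : y * (v * (s m - x)) = u * ((s m - x) * y * v) * (s m - x).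
      by rewrite !mulrA um mul1r.
    by rewrite vy mulr1.
  have -> : s l - x = v * (s m - x).
    by rewrite -[LHS]mulr1 -yy mulrA ly mul1r.
  by exists y; split=> //; rewrite -mulrA.
have cy : s (l - m) * y = y * s (l - m) by exact: (banach_central hB).
have e2 : y * (s m - x) = 1 - s (l - m) * y.
  by rewrite cy -ly rmorphB; ncring.
rewrite -e2 in vy yv.
have yy : (s m - x) * v * y = 1.
  have -> : (s m - x) * v * y = (s m - x) * (v * (y * (s m - x))) * u.
    by rewrite -!mulrA mu mulr1.
  by rewrite yv mulr1.
have -> : s l - x = (s m - x) * v.
  by rewrite -[LHS]mul1r -yy -mulrA ly mulr1.
by exists y; split=> //; rewrite mulrA.
Qed.

Lemma invertible_large l x : 2 * nrm x < normc l -> invertible (s l - x).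
Proof.
move=> h; have nl : 0 < normc l by apply: le_lt_trans h; rewrite mulr_ge0.
have l0 : l != 0 by apply/eqP => l0; move: nl; rewrite l0 normc0 ltxx.
have -> : s l - x = s l * (1 - s l^-1 * x).
  by rewrite mulrBr mulr1 mulrA -rmorphM mulfV // rmorph1 mul1r.
apply: invertible_scale => //; apply: (invertible_1sub_small hB).
rewrite (banach_scale hB) normcV mulrC ler_pdivrMr //; lra.
Qed.

(* The boundary of the spectrum consists of points where x - l is invertible on
   neither side, and the complement of a finite set is connected. *)
Lemma invertible_off_finite (F : seq R[i]) x :
  (forall l, l \notin F -> exists y, one_sided_inverse (s l - x) y) ->
  forall l, l \notin F -> invertible (s l - x).
Proof.
move=> H l lF; apply: contrapT => nl.
have [M HM] := ray_avoiding F l; pose o := (1 +i* M)%C.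
pose pt (t : R) : R[i] := l + t%:C%C * o.
have pt_sub t t' : normc (pt t' - pt t) = `|t' - t| * normc o.
  have -> : pt t' - pt t = (t' - t)%:C%C * o.
    by rewrite /pt opprD addrACA subrr add0r rmorphB mulrBl.
  by rewrite normcM normcR.
(* The ray meets the spectrum for bounded parameters only; the contradiction is drawn at their
   supremum. *)
pose T := [set t : R | 0 <= t /\ ~ invertible (s (pt t) - x)]%classic.
have T0 : T 0 by split=> //; rewrite /pt rmorph0 mul0r addr0.
have Tub t : T t -> t <= 2 * nrm x + `|complex.Re l|.
  move=> [t0 nt]; rewrite leNgt; apply/negP => ht; apply: nt.
  apply: invertible_large.
  have : `|complex.Re (pt t)| <= normc (pt t).
    by have := rect_normc (complex.Re (pt t)) (complex.Im (pt t)); case: (pt t) => ? ? [].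
  have -> : complex.Re (pt t) = complex.Re l + t.
    by rewrite /pt /o; case: (l) => ? ? /=; rewrite mul0r subr0 mulr1.
  have := ler_norm (complex.Re l + t); have := ler_norm (- complex.Re l); rewrite normrN; lra.
have hT : has_sup T by split; [exists 0|exists (2 * nrm x + `|complex.Re l|) => t /Tub].
have Tle t : T t -> t <= sup T by move=> Tt; exact: (sup_upper_bound hT).
have S0 : 0 <= sup T by exact: Tle.
have SF : pt (sup T) \notin F.
  move: S0; rewrite le_eqVlt => /orP[/eqP <-|]; last exact: HM.
  by rewrite /pt rmorph0 mul0r addr0.
have no0 : 0 <= normc o by exact: normc_ge0.
have small y : exists2 d, 0 < d & d * normc o * nrm y <= 2^-1.
  have c0 : 0 <= normc o * nrm y by rewrite mulr_ge0.
  exists (2^-1 / (normc o * nrm y + 1)).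
    by rewrite divr_gt0 ?invr_gt0 // ltr_wpDl.
  rewrite -mulrA mulrAC ler_pdivrMr; lra.
have [y Hy] := H _ SF.
(* Points of the ray just beyond [sup T] are off the spectrum, which makes the one-sided inverse at
   [sup T] two-sided. *)
have iS : invertible (s (pt (sup T)) - x).
  have [d d0 hd] := small y.
  apply: (invertible_limit (m := pt (sup T + d)) Hy).
    by rewrite pt_sub addrC addKr gtr0_norm.
  apply: contrapT => nd; have /Tle : T (sup T + d) by split=> //; lra.
  lra.
(* Invertibility is an open condition, so it extends to parameters just before [sup T], some of
   which belong to [T]. *)
have [z [lz zl]] := iS; have [d d0 hd] := small z.
have [t [t0 nt] ht] := sup_adherent d0 hT.
have tS : t <= sup T by apply: Tle; split.
apply: nt; apply: (invertible_near lz zl).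
rewrite pt_sub; apply: le_trans hd; apply: ler_wpM2r => //.
apply: ler_wpM2r => //.
by rewrite ler_norml; apply/andP; split; lra.
Qed.

End Boundary.

(** * Annihilated words and the quadratic pencil *)

Section Annihilation.
Variables (K : fieldType) (B : nzRingType) (s : {rmorphism K -> B}).
Hypothesis central : forall l x, s l * x = x * s l.
Variables a d : B.
Implicit Types x y z : B.

(** Peeling off the letter next to [y] replaces the indexed products of the hypothesis by a form
    suited to induction. *)
Fixpoint kills_words j y :=
  if j is j'.+1 then kills_words j' (y * a) /\ kills_words j' (y * d) else y = 0.

Lemma kills_wordsP j y :
  (forall al : 'I_j -> B, (forall i, al i = a \/ al i = d) ->
     y * \prod_(i < j) al i = 0) -> kills_words j y.
Proof.
elim: j y => [|j IH] y H.
  by have := H (fun _ => a) (fun _ => or_introl erefl); rewrite big_ord0 mulr1.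
have Hx x : x = a \/ x = d -> kills_words j (y * x).
  move=> xad; apply: IH => al Hal.
  have := H (fun i => if unlift ord0 i is Some i' then al i' else x).
  rewrite big_ord_recl unlift_none mulrA => Hi; rewrite -[RHS]Hi; last first.
    by move=> i; case: (unlift ord0 i).
  by congr (_ * _); apply: eq_bigr => i _; rewrite liftK.
by split; apply: Hx; [left|right].
Qed.

Lemma kills_wordsD j x y : kills_words j x -> kills_words j y -> kills_words j (x + y).
Proof.
elim: j x y => [|j IH] x y /=; first by move=> -> ->; rewrite addr0.
by move=> [xa xd] [ya yd]; rewrite !mulrDl; split; exact: IH.
Qed.

Lemma kills_wordsM j x y : kills_words j y -> kills_words j (x * y).
Proof.
elim: j y => [|j IH] y /=; first by move=> ->; rewrite mulr0.
by move=> [ya yd]; rewrite -!mulrA; split; exact: IH.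
Qed.

Lemma kills_wordsS j y : kills_words j y -> kills_words j.+1 y.
Proof.
elim: j y => [|j IH] y; first by move=> /= ->; rewrite !mul0r.
by move=> [ya yd]; split; exact: IH.
Qed.

(* Iterating l y G = y + y (p a + q d) G turns y G into a linear combination of
   the y w with w a word, up to a remainder that is killed. *)
Lemma kills_words_inverse l p q G j y : l != 0 ->
  (s l - (s p * a + s q * d)) * G = 1 -> kills_words j y -> kills_words j (y * G).
Proof.
move=> l0 HG; elim: j y => [|j IH] y; first by move=> /= ->; rewrite mul0r.
move=> Hy; have [ya yd] := Hy.
have -> : y * G = s l^-1 * (y + s p * (y * a * G) + s q * (y * d * G)).
  have e : s l * (y * G) = y + s p * (y * a * G) + s q * (y * d * G).
    have -> : s p * (y * a * G) = y * (s p * a) * G.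
      by rewrite !mulrA (central p y).
    have -> : s q * (y * d * G) = y * (s q * d) * G.
      by rewrite !mulrA (central q y).
    have e0 : y * ((s l - (s p * a + s q * d)) * G) = y by rewrite HG mulr1.
    by rewrite -[X in _ = X + _ + _]e0 mulrA (central l y); ncring.
  by rewrite -e mulrA -rmorphM mulVf // rmorph1 mul1r.
apply: kills_wordsM; apply: kills_wordsD; first apply: kills_wordsD => //.
  by apply: kills_wordsM; apply: kills_wordsS; exact: IH.
by apply: kills_wordsM; apply: kills_wordsS; exact: IH.
Qed.

(** Multiplication by [a * d * G] lowers the required word length by one: [a] uses up a letter,
    while [d] and [G] never raise the length. Starting from [a * d * G], another [k] factors give
    0. *)
Lemma kills_words_nilpotent k G :
  (forall j y, kills_words j y -> kills_words j (y * G)) ->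
  kills_words k (a * d) -> invertible (1 - a * d * G).
Proof.
move=> HG Hk; apply: (@invertible_nilpotent _ _ k.+1).
have H j y : kills_words j y -> y * (a * d * G) ^+ j = 0.
  elim: j y => [|j IH] y; first by move=> /= ->; rewrite mul0r.
  move=> [ya _]; rewrite exprS mulrA; apply: IH; rewrite !mulrA; apply: HG.
  by have [] := kills_wordsS ya.
by rewrite exprS; apply: H; exact: HG.
Qed.

Definition pencil l : B := s (l * l) - s l * a - d.

Lemma pencil_factor l :
  (s l - a) * (s (l * l) - d) = s l * pencil l + a * d.
Proof.
have -> : (s l - a) * (s (l * l) - d) =
  s l * s (l * l) - s l * d - a * s (l * l) + a * d by ncring.
by rewrite -(central (l * l) a) /pencil rmorphM; ncring.
Qed.

(** With [G = v' * u'] the inverse of the product [P] of the two given elements, [pencil_factor]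
    reads [s l * pencil l = (1 - a * d * G) * P]. Both inverses are instances of
    [kills_words_inverse]. *)
Lemma pencil_invertible k l : kills_words k (a * d) -> l != 0 ->
  invertible (s l - a) -> invertible (s (l * l) - d) -> invertible (pencil l).
Proof.
move=> Hk l0 iu iv; have ll : l * l != 0 by rewrite mulf_neq0.
have [u' [uu' u'u]] := iu; have [v' [vv' v'v]] := iv.
have HG j y : kills_words j y -> kills_words j (y * (v' * u')).
  move=> Hy; rewrite mulrA.
  apply: (@kills_words_inverse l 1 0); rewrite ?rmorph1 ?rmorph0 ?mul1r ?mul0r ?addr0 //.
  by apply: (@kills_words_inverse (l * l) 0 1); rewrite ?rmorph1 ?rmorph0 ?mul1r ?mul0r ?add0r.
have iN := kills_words_nilpotent HG Hk.
have -> : pencil l = s l^-1 * ((1 - a * d * (v' * u')) * ((s l - a) * (s (l * l) - d))).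
  have -> : (1 - a * d * (v' * u')) * ((s l - a) * (s (l * l) - d)) =
    (s l - a) * (s (l * l) - d) - a * d * (v' * (u' * (s l - a)) * (s (l * l) - d)).
    by ncring.
  rewrite u'u mulr1 v'v mulr1 pencil_factor addrK mulrA -rmorphM mulVf //.
  by rewrite rmorph1 mul1r.
apply: invertible_scale; first by rewrite invr_eq0.
by apply: invertibleM => //; exact: invertibleM.
Qed.

(** Here [G] is minus the inverse of [s l * pencil l], so the product is
    [(1 - a * d * G) * (s l * pencil l)], hence invertible; this yields only a right inverse of its
    first factor and a left inverse of its second. *)
Lemma one_sided_of_pencil k l : kills_words k (a * d) -> l != 0 ->
  invertible (pencil l) ->
  (exists y, (s l - a) * y = 1) /\ (exists y, y * (s (l * l) - d) = 1).
Proof.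
move=> Hk l0 iT; have [T' [TT' T'T]] := iT; have ll : l * l != 0 by rewrite mulf_neq0.
pose G := s (- l^-1) * T'.
have HG j y : kills_words j y -> kills_words j (y * G).
  move=> Hy; rewrite /G mulrA -central -mulrA; apply: kills_wordsM.
  apply: (@kills_words_inverse (l * l) l 1) => //.
  by rewrite rmorph1 mul1r opprD addrA.
have [w [uvw wuv]] : invertible ((s l - a) * (s (l * l) - d)).
  have -> : (s l - a) * (s (l * l) - d) = (1 - a * d * G) * (s l * pencil l).
    have GT : G * (s l * pencil l) = - 1.
      rewrite /G -mulrA (mulrA T') -central -mulrA T'T mulr1 -rmorphM.
      by rewrite mulNr mulVf // rmorphN1.
    by rewrite [RHS]mulrBl mul1r -(mulrA (a * d)) GT pencil_factor mulrN1 opprK.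
  apply: invertibleM; first exact: kills_words_nilpotent HG Hk.
  exact: invertible_scale.
split; first by exists ((s (l * l) - d) * w); rewrite mulrA.
by exists (w * (s l - a)); rewrite -mulrA.
Qed.

End Annihilation.

(** * Explicit 2 by 2 matrices *)

Section Matrix2.
Variable B : nzRingType.

(** With [t = 0] this is [M2] up to conversion, so results on [mx4] apply to the theorem
    directly. *)
Definition mx4 (p q r t : B) : 'M[B]_2 :=
  \matrix_(i < 2, j < 2)
    if (i == 0 :> nat) then (if (j == 0 :> nat) then p else q)
    else (if (j == 0 :> nat) then r else t).

Lemma ord2P (i : 'I_2) : i = ord0 \/ i = ord_max.
Proof. by case: i => [[|[|//]] i2]; [left|right]; exact: val_inj. Qed.

Lemma mx4P (M : 'M[B]_2) :
  M = mx4 (M ord0 ord0) (M ord0 ord_max) (M ord_max ord0) (M ord_max ord_max).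
Proof.
by apply/matrixP => i j; rewrite mxE; case: (ord2P i) => ->; case: (ord2P j) => ->.
Qed.

Lemma mx4_inj p q r t p' q' r' t' : mx4 p q r t = mx4 p' q' r' t' ->
  [/\ p = p', q = q', r = r' & t = t'].
Proof.
move=> /matrixP H; have := H ord0 ord0; have := H ord0 ord_max.
by have := H ord_max ord0; have := H ord_max ord_max; rewrite !mxE.
Qed.

Lemma mx4M p q r t p' q' r' t' : mx4 p q r t * mx4 p' q' r' t' =
  mx4 (p * p' + q * r') (p * q' + q * t') (r * p' + t * r') (r * q' + t * t').
Proof.
apply/matrixP => i j; rewrite !mxE !big_ord_recl big_ord0 addr0 !mxE.
by case: (ord2P i) => ->; case: (ord2P j) => ->.
Qed.

Lemma mx4D p q r t p' q' r' t' :
  mx4 p q r t + mx4 p' q' r' t' = mx4 (p + p') (q + q') (r + r') (t + t').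
Proof.
apply/matrixP => i j; rewrite !mxE.
by case: (ord2P i) => ->; case: (ord2P j) => ->.
Qed.

Lemma mx4N p q r t : - mx4 p q r t = mx4 (- p) (- q) (- r) (- t).
Proof.
apply/matrixP => i j; rewrite !mxE.
by case: (ord2P i) => ->; case: (ord2P j) => ->.
Qed.

Lemma scalar_mx4 (p : B) : p%:M = mx4 p 0 0 p.
Proof.
apply/matrixP => i j; rewrite !mxE.
by case: (ord2P i) => ->; case: (ord2P j) => ->.
Qed.

Lemma mx4_1 : 1 = mx4 1 0 0 1.
Proof. exact: scalar_mx4. Qed.

End Matrix2.

(** * The Banach algebra of 2 by 2 matrices *)

Section MatrixBanach.
Variables (R : realType) (B : nzRingType) (s : {rmorphism R[i] -> B}).
Variables (nrm : B -> R) (hB : banach_over_complex s nrm).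
Let bge0 := bnrm_ge0 hB.
Hint Resolve bge0 : core.

Definition scalar2 : {rmorphism R[i] -> 'M[B]_2} := (@scalar_mx B 2) \o s.

(** [gpi_hirano] mentions no norm, so any complete submultiplicative norm serves for the
    matrices. *)
Definition nrm2 (M : 'M[B]_2) : R := nrm (M ord0 ord0) + nrm (M ord0 ord_max) +
  nrm (M ord_max ord0) + nrm (M ord_max ord_max).

Lemma nrm2_mx4 p q r t : nrm2 (mx4 p q r t) = nrm p + nrm q + nrm r + nrm t.
Proof. by rewrite /nrm2 !mxE. Qed.

Lemma scalar2E l : scalar2 l = mx4 (s l) 0 0 (s l).
Proof. exact: scalar_mx4. Qed.

Lemma nrm2_entry (M : 'M[B]_2) i j : nrm (M i j) <= nrm2 M.
Proof.
rewrite /nrm2; have := bge0 (M ord0 ord0); have := bge0 (M ord0 ord_max).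
have := bge0 (M ord_max ord0); have := bge0 (M ord_max ord_max).
by case: (ord2P i) => ->; case: (ord2P j) => ->; lra.
Qed.

Lemma banach_matrix2 : banach_over_complex scalar2 nrm2.
Proof.
split.
- move=> l M; rewrite scalar2E (mx4P M) !mx4M.
  by rewrite !(mul0r, mulr0, add0r, addr0) !(banach_central hB).
- by move=> M; rewrite !addr_ge0.
- move=> M M0; have H i j : M i j = 0.
    by apply: (bnrm_eq0 hB); rewrite -M0; exact: nrm2_entry.
  by apply/matrixP => i j; rewrite H mxE.
- move=> M N; rewrite (mx4P M) (mx4P N) mx4D !nrm2_mx4.
  have D x y := bnrm_leD hB x y.
  have := D (M ord0 ord0) (N ord0 ord0); have := D (M ord0 ord_max) (N ord0 ord_max).
  have := D (M ord_max ord0) (N ord_max ord0).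
  have := D (M ord_max ord_max) (N ord_max ord_max); lra.
- move=> l M; rewrite scalar2E (mx4P M) mx4M !nrm2_mx4.
  by rewrite !(mul0r, mulr0, add0r, addr0) !(banach_scale hB) !mulrDr.
- move=> M N; rewrite (mx4P M) (mx4P N) mx4M !nrm2_mx4.
  move: (M ord0 ord0) (M ord0 ord_max) (M ord_max ord0) (M ord_max ord_max) => p q r t.
  move: (N ord0 ord0) (N ord0 ord_max) (N ord_max ord0) (N ord_max ord_max) => p' q' r' t'.
  have H x y z w : nrm (x * y + z * w) <= nrm x * nrm y + nrm z * nrm w.
    apply: le_trans (bnrm_leD hB _ _) _; exact: lerD (bnrm_leM hB _ _) (bnrm_leM hB _ _).
  (* The product of the two sums has sixteen terms: eight occur in the matrix product and the other
     eight are nonnegative. *)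
  have P x y : 0 <= nrm x * nrm y by rewrite mulr_ge0.
  have := H p p' q r'; have := H p q' q t'; have := H r p' t r'; have := H r q' t t'.
  have := P p r'; have := P p t'; have := P q p'; have := P q q'.
  have := P r r'; have := P r t'; have := P t p'; have := P t q'; lra.
move=> u Hu.
have /choice[l Hl] : forall ij : 'I_2 * 'I_2, exists l : B, forall e : R, 0 < e ->
    exists N, forall n, (N <= n)%N -> nrm (u n ij.1 ij.2 - l) < e.
  move=> [i j]; apply: (banach_complete hB) => e e0.
  have [N HN] := Hu e e0; exists N => m n Nm Nn.
  apply: le_lt_trans (HN m n Nm Nn).
  by have := nrm2_entry (u m - u n) i j; rewrite !mxE.
exists (\matrix_(i, j) l (i, j)) => e e0.
have e4 : 0 < e / 4 by rewrite divr_gt0.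
have [N1 H1] := Hl (ord0, ord0) _ e4; have [N2 H2] := Hl (ord0, ord_max) _ e4.
have [N3 H3] := Hl (ord_max, ord0) _ e4; have [N4 H4] := Hl (ord_max, ord_max) _ e4.
exists (N1 + N2 + N3 + N4)%N => n Nn.
rewrite /nrm2 !mxE.
have h1 : nrm (u n ord0 ord0 - l (ord0, ord0)) < e / 4.
  by apply: (H1 n (leq_trans _ Nn)); rewrite -!addnA leq_addr.
have h2 : nrm (u n ord0 ord_max - l (ord0, ord_max)) < e / 4.
  by apply: (H2 n (leq_trans _ Nn)); rewrite -!addnA addnCA leq_addr.
have h3 : nrm (u n ord_max ord0 - l (ord_max, ord0)) < e / 4.
  by apply: (H3 n (leq_trans _ Nn)); rewrite -addnA addnCA leq_addr.
have h4 : nrm (u n ord_max ord_max - l (ord_max, ord_max)) < e / 4.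
  by apply: (H4 n (leq_trans _ Nn)); rewrite leq_addl.
lra.
Qed.

(* The Schur complement of the lower right entry of l - M is l^-1 (l^2 - l a - b c). *)
Lemma invertible_matrix_pencil a b c l : l != 0 ->
  invertible (scalar2 l - mx4 a b c 0) <-> invertible (pencil s a (b * c) l).
Proof.
move=> l0; rewrite scalar2E mx4N mx4D !add0r oppr0 addr0.
have ll : s l^-1 * s l = 1 by rewrite -rmorphM mulVf // rmorph1.
have ll' : s l * s l^-1 = 1 by rewrite -rmorphM mulfV // rmorph1.
have C m x : s m * x = x * s m := banach_central hB m x.
set T := pencil s a (b * c) l.
have TE : T = s l * (s l - a) - b * c by rewrite /T /pencil rmorphM; ncring.
have TE' : T = (s l - a) * s l - b * c by rewrite -C.
split=> [[N [MN NM]]|[E [TE1 ET]]].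
  rewrite (mx4P N) !mx4M !mx4_1 in MN NM.
  move: (N ord0 ord0) (N ord0 ord_max) (N ord_max ord0) (N ord_max ord_max) MN NM.
  move=> p q r t /mx4_inj[e1 _ e3 _] /mx4_inj[f1 f2 _ _].
  (* The upper left entry [p] of the inverse matrix inverts the Schur complement [s l^-1 * T]. *)
  apply: (@invertible_lr _ _ (p * s l^-1) (s l^-1 * p)).
    have -> : T * (p * s l^-1) = s l * ((s l - a) * p - s l^-1 * (b * c * p)) * s l^-1.
      have -> : s l * ((s l - a) * p - s l^-1 * (b * c * p)) * s l^-1 =
        (s l * (s l - a) * p - (s l * s l^-1) * (b * c * p)) * s l^-1 by ncring.
      by rewrite ll' TE; ncring.
    have -> : s l^-1 * (b * c * p) = b * r.
      have -> : b * c * p = b * (c * p) by ncring.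
      have -> : c * p = s l * r.
        by apply/subr0_eq; rewrite -[RHS]oppr0 -e3; ncring.
      by rewrite (mulrA b) -C -mulrA mulrA ll mul1r.
    have -> : (s l - a) * p - b * r = 1 by rewrite -e1; ncring.
    by rewrite mulr1 ll'.
  have -> : s l^-1 * p * T = s l^-1 * (p * (s l - a) - p * b * c * s l^-1) * s l.
    have -> : s l^-1 * (p * (s l - a) - p * b * c * s l^-1) * s l =
      s l^-1 * (p * ((s l - a) * s l) - p * b * c * (s l^-1 * s l)) by ncring.
    by rewrite ll TE'; ncring.
  have -> : p * b * c * s l^-1 = q * c.
    have -> : p * b = q * s l.
      by apply/esym/subr0_eq; rewrite -f2; ncring.
    by rewrite -mulrA -(C l^-1 c) mulrA -(mulrA q) ll' mulr1.
  have -> : p * (s l - a) - q * c = 1 by rewrite -f1; ncring.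
  by rewrite mulr1 ll.
(* Block inversion, with [s l * E] as the inverse of the Schur complement. *)
exists (mx4 (s l * E) (E * b) (c * E) (s l^-1 * (1 + c * E * b))).
rewrite !mx4M !mx4_1; split; congr mx4.
- have -> : (s l - a) * (s l * E) + - b * (c * E) = ((s l - a) * s l - b * c) * E by ncring.
  by rewrite -TE'.
- have -> : (s l - a) * (E * b) + - b * (s l^-1 * (1 + c * E * b)) =
    (s l - a) * E * b - (b * s l^-1) * (1 + c * E * b) by ncring.
  rewrite -C.
  have -> : (s l - a) * E * b = s l^-1 * ((s l * (s l - a)) * E * b).
    by rewrite !mulrA ll mul1r.
  have -> : s l * (s l - a) = T + b * c by rewrite TE subrK.
  have -> : (T + b * c) * E * b = (T * E) * b + b * c * E * b by ncring.
  by rewrite TE1; ncring.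
- have -> : - c * (s l * E) + s l * (c * E) = (s l * c - c * s l) * E by ncring.
  by rewrite C subrr mul0r.
- have -> : - c * (E * b) + s l * (s l^-1 * (1 + c * E * b)) =
    (s l * s l^-1) * (1 + c * E * b) - c * E * b by ncring.
  by rewrite ll' mul1r addrK.
- have -> : s l * E * (s l - a) + E * b * - c = E * s l * (s l - a) - E * b * c.
    by rewrite C; ncring.
  have -> : E * s l * (s l - a) - E * b * c = E * (s l * (s l - a) - b * c) by ncring.
  by rewrite -TE.
- have -> : s l * E * - b + E * b * s l = (E * b) * s l - s l * (E * b) by ncring.
  by rewrite C subrr.
- have -> : c * E * (s l - a) + s l^-1 * (1 + c * E * b) * - c =
     c * E * (s l - a) - s l^-1 * c - s l^-1 * (c * E) * b * c by ncring.
  have -> : c * E * (s l - a) = s l^-1 * (c * E * (s l * (s l - a))).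
    have -> : c * E * (s l * (s l - a)) = (c * E * s l) * (s l - a) by ncring.
    by rewrite -C !mulrA ll mul1r.
  have -> : s l * (s l - a) = T + b * c by rewrite TE subrK.
  have -> : c * E * (T + b * c) = c * (E * T) + c * E * b * c by ncring.
  by rewrite ET; ncring.
- have -> : c * E * - b + s l^-1 * (1 + c * E * b) * s l =
    s l^-1 * ((1 + c * E * b) * s l) - c * E * b by ncring.
  by rewrite -C mulrA ll mul1r addrK.
Qed.

End MatrixBanach.

Lemma banach_algebra_over_complex (R : realType) (A : algType R[i]) (nrm : A -> R) :
  banach_algebra nrm -> banach_over_complex (in_alg A) nrm.
Proof.
move=> [ge0 [eq0 [leD [scale [leM [_ compl]]]]]]; split=> //.
- by move=> l x; rewrite /= mulr_algl mulr_algr.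
- by move=> x /eq0.
- move=> l x; rewrite /= mulr_algl; have := scale l x.
  by rewrite -[`|l|]/((normc l)%:C%C) -rmorphM => /(congr1 (@complex.Re R)).
Qed.

(** * Transfer of the spectral condition between the matrix and its entries *)

Section Pencil.
Variables (R : realType) (B : nzRingType) (s : {rmorphism R[i] -> B}).
Variables (nrm : B -> R) (hB : banach_over_complex s nrm).
Variables (a b c : B) (k : nat).
Hypothesis hk : kills_words a (b * c) k (a * (b * c)).

(** Either of [l ^+ m = 1] and [(l * l) ^+ n = 1] implies [l ^+ (m * n * 2) = 1]. *)
Lemma unity_spectrum_matrix m n : (0 < m)%N -> (0 < n)%N ->
  unity_spectrum s m a -> unity_spectrum s n (b * c) ->
  unity_spectrum (scalar2 s) (m * n * 2) (mx4 a b c 0).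
Proof.
move=> m0 n0 Ha Hd l lN.
have l0 : l != 0 by apply: contraNneq lN => ->; rewrite expr0n.
have lN1 : l ^+ (m * n * 2) != 1.
  by apply: contraNneq lN => h; rewrite exprS h mulr1.
apply/(invertible_matrix_pencil hB _ _ _ l0)/(pencil_invertible (banach_central hB) hk l0).
  apply: Ha; apply: contraNneq lN1 => h; rewrite -mulnA exprM.
  by rewrite (_ : l ^+ m = 1) ?expr1n //; apply: (mulfI l0); rewrite -exprS h mulr1.
apply: Hd; apply: contraNneq lN1 => h; have ll0 : l * l != 0 by rewrite mulf_neq0.
rewrite mulnC exprM expr2 mulnC exprM.
by rewrite (_ : (l * l) ^+ n = 1) ?expr1n //; apply: (mulfI ll0); rewrite -exprS h mulr1.
Qed.

Lemma unity_spectrum_entries n : (0 < n)%N ->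
  unity_spectrum (scalar2 s) n (mx4 a b c 0) ->
  unity_spectrum s n a /\ unity_spectrum s n (b * c).
Proof.
move=> n0 HM.
(* The exceptional scalars are the roots of a nonzero polynomial, hence form a finite list [F]. *)
have n1 : ('X^(n.+1) - 'X : {poly R[i]}) != 0.
  rewrite -size_poly_gt0 size_polyDl ?size_polyXn // size_polyN size_polyX.
  by rewrite ltnS.
have [F HF] := closed_field_poly_normal ('X^(n.+1) - 'X : {poly R[i]}).
have FP l : (l \in F) = (l ^+ n.+1 == l).
  have := congr1 (fun q => root q l) HF.
  rewrite rootZ ?lead_coef_eq0 // root_prod_XsubC => <-.
  by rewrite rootE !hornerE subr_eq0.
have F0 l : l \notin F -> l != 0.
  by rewrite FP; apply: contraNneq => ->; rewrite expr0n.
have H l : l \notin F ->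
  (exists y, (s l - a) * y = 1) /\ (exists y, y * (s (l * l) - b * c) = 1).
  move=> lF; have l0 := F0 l lF.
  apply: (one_sided_of_pencil (banach_central hB) hk l0).
  by apply/(invertible_matrix_pencil hB _ _ _ l0)/HM; rewrite -FP.
split=> l; rewrite -FP => lF; apply: (invertible_off_finite hB (F := F)) => // {lF}l lF.
  by have [[y ly] _] := H l lF; exists y; left.
(* The pencil controls [b * c] at squares, so it is used at a square root of [l]; that root is off
   [F], because [F] is stable under squaring. *)
have e : sqrtC l * sqrtC l = l by rewrite -expr2 sqrtCK.
have [|_ [y]] := H (sqrtC l); last by rewrite e => ly; exists y; right.
apply: contra lF; rewrite !FP => /eqP h.
by rewrite -{1}e -expr2 exprAC h expr2 e.
Qed.

End Pencil.

Theorem theorem4p6 (R : realType) (A : algType R[i]) (nrm : A -> R)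
  (hA : banach_algebra nrm) (a b c : A) (k : nat) (hk : (0 < k)%N)
  (h : forall alpha : 'I_k -> A, (forall i, alpha i = a \/ alpha i = b * c) ->
         a * (b * c) * \prod_(i < k) alpha i = 0) :
  (gpi_hirano (@scalA R A) a /\ gpi_hirano (@scalA R A) (b * c)) <->
  gpi_hirano (@scalM2 R A) (M2 a b c).
Proof.
have hB := banach_algebra_over_complex hA.
have hM := banach_matrix2 hB.
have Hk := kills_wordsP h.
split=> [[]|].
  move=> /(unity_spectrum_of_gpi_hirano hB)[m m0 Hm].
  move=> /(unity_spectrum_of_gpi_hirano hB)[n n0 Hn].
  apply: (gpi_hirano_of_unity_spectrum hM (n := (m * n * 2)%N)).
    by rewrite !muln_gt0 m0 n0.
  exact: (unity_spectrum_matrix hB Hk).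
move=> /(unity_spectrum_of_gpi_hirano hM)[n n0 Hn].
have [Ha Hd] := unity_spectrum_entries hB Hk n0 Hn.
by split; apply: (gpi_hirano_of_unity_spectrum hB n0).
Qed.
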